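(* Let $W$ be an $8$-dimensional real vector space equipped with an $\mathrm{SU}(4)$-structure $(\Omega,J,\Theta)$. Then the alternating multi-linear map $$\Phi:=\tfrac12\Omega\wedge\Omega+\mathrm{Re}\,\Theta\in\Lambda^4W^*$$ is a positive Cayley calibration, compatible with the complex orientation and the inner product. Moreover, the subspaces $\Lambda^2_7:=\{\tau\in\Lambda^2W^*: *(\Phi\wedge\tau)=3\tau\}$ and $\Lambda^2_{21}:=\{\tau\in\Lambda^2W^*: *(\Phi\wedge\tau)=-\tau\}$ associated to $\Phi$ are given by \begin{align*} \Lambda^2_7&=\mathbb{R}\Omega\oplus\{\tau\in\Lambda^{2,0}+\Lambda^{0,2}: *(\mathrm{Re}\,\Theta\wedge\tau)=2\tau\},\\ \Lambda^2_{21}&=\{\tau\in\Lambda^{1,1}:\tau\wedge\Omega^3=0\}\oplus\{\tau\in\Lambda^{2,0}+\Lambda^{0,2}: *(\mathrm{Re}\,\Theta\wedge\tau)=-2\tau\}. \end{align*}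
   Context: Let $W$ be a $2n$-dimensional real vector space. An $\mathrm{SU}(n)$-structure on $W$ is a triple $(\omega,J,\theta)$ consisting of a nondegenerate $2$-form $\omega\in\Lambda^2W^*$, an $\omega$-compatible complex structure $J:W\to W$ (so that $\langle\cdot,\cdot\rangle:=\omega(\cdot,J\cdot)$ is an inner product), and a complex multi-linear alternating map $\theta:W^n\to\mathbb{C}$ which has norm $2^{n/2}$ with respect to the metric determined by $\omega$ and $J$. The archetypal example is $W=\mathbb{C}^n$ with $\omega=\sum_jdx_j\wedge dy_j$, $J=i$, $\theta=dz_1\wedge\dots\wedge dz_n$ (whose norm is $2^{n/2}$ in this normalization). In this statement $n=4$, the inner product on $W$ is $\Omega(\cdot,J\cdot)$, the orientation is the complex one, with volume form $\frac1{24}\Omega^4$, and $*$ is the corresponding Hodge operator. $\Lambda^{1,1}$ and $\Lambda^{2,0}+\Lambda^{0,2}$ denote the subspaces of real $2$-forms on $W$ of the indicated types with respect to $J$. A triple cross product on a real Hilbert space $W$ is an alternating multi-linear map $(u,v,w)\mapsto u\times v\times w$ with $u\times v\times w$ orthogonal to $u,v,w$ and $|u\times v\times w|=|u\wedge v\wedge w|$ (square root of the Gram determinant). An inner product on $W$ is compatible with a $4$-form $\Phi$ if the map defined by $\langle x,u\times v\times w\rangle:=\Phi(x,u,v,w)$ is a triple cross product; then $\Phi$ is called a Cayley form (Cayley calibration). A Cayley form $\Phi$ on an $8$-dimensional space is positive if the $8$-forms $\Phi\wedge\Phi$ and $\iota(v)\iota(u)\Phi\wedge\iota(v)\iota(u)\Phi\wedge\Phi$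 induce the same orientation whenever $u,v$ are linearly independent; for a positive Cayley form, compatibility with an orientation means that it is the orientation induced by these $8$-forms. *)

(* Defs.v *)
From HB Require Import structures.
From mathcomp Require Import all_boot all_order all_algebra perm.
From mathcomp Require Import boolp classical_sets functions reals.
From mathcomp Require Import complex.

Set Implicit Arguments.
Unset Strict Implicit.
Unset Printing Implicit Defensive.

Import Order.TTheory GRing.Theory Num.Theory.
Local Open Scope classical_set_scope.
Local Open Scope ring_scope.
Local Open Scope complex_scope.

(* A real k-form is a function on k.-tuple W with values in R^o, a complex one
   a function with values in Rcomplex R, which is R[i] with its structure of
   algebra over R. Being a form is the predicate alternating_multilinear. *)

Definition setslot (T : Type) (k : nat) (v : k.-tuple T) (i : 'I_k) (x : T) :
    k.-tuple T :=
  [tuple if j == i then x else tnth v j | j < k].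

Section Alternating.
Variables (R : realType) (W : vectType R).

Definition multilinear (V : lmodType R) (k : nat) (f : k.-tuple W -> V) :=
  forall (v : k.-tuple W) (i : 'I_k) (a : R) (x y : W),
    f (setslot v i (a *: x + y)) = a *: f (setslot v i x) + f (setslot v i y).

Definition alternating (V : lmodType R) (k : nat) (f : k.-tuple W -> V) :=
  forall (v : k.-tuple W) (i j : 'I_k),
    i != j -> tnth v i = tnth v j -> f v = 0.

Definition alternating_multilinear (V : lmodType R) (k : nat)
    (f : k.-tuple W -> V) :=
  multilinear f /\ alternating f.

(* Normalized so that (a /\ b)(u, v) = a(u) b(v) - a(v) b(u) on 1-forms. *)
Definition wedge (K : lalgType R) (p q : nat)
    (a : p.-tuple W -> K) (b : q.-tuple W -> K) : (p + q).-tuple W -> K :=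
  fun v => ((p`! * q`!)%:R)^-1 *:
    \sum_(s : 'S_(p + q)) (-1) ^+ s *
       (a [tuple tnth v (s (lshift q i)) | i < p] *
        b [tuple tnth v (s (rshift p j)) | j < q]).

Definition interior (V : lmodType R) (k : nat) (u : W)
    (f : k.+1.-tuple W -> V) : k.-tuple W -> V :=
  fun v => f [tuple of u :: v].

(* For forms of top degree: both are nonzero and induce the same orientation. *)
Definition same_orientation (k : nat) (f g : k.-tuple W -> R^o) :=
  f <> 0 /\ exists2 c : R, 0 < c & g = c *: f.

End Alternating.

Section Metric.
Variables (R : realType) (W : vectType R).

Definition is_inner_product (g : W -> W -> R) :=
  [/\ forall (a : R) (x y z : W), g (a *: x + y) z = a * g x z + g y z,
      forall x y : W, g x y = g y x
    & forall x : W, x != 0 -> 0 < g x x].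

Definition is_orthonormal_basis (g : W -> W -> R)
    (e : (\dim {:W}).-tuple W) :=
  basis_of fullv e /\ forall i j, g (tnth e i) (tnth e j) = (i == j)%:R.

(* An arbitrary choice, on which nothing below depends. *)
Definition orthonormal_basis (g : W -> W -> R) : (\dim {:W}).-tuple W :=
  xget (vbasis {:W}) [set e | is_orthonormal_basis g e].

Definition basis_tuple (g : W -> W -> R) (k : nat)
    (I : {ffun 'I_k -> 'I_(\dim {:W})}) : k.-tuple W :=
  [tuple tnth (orthonormal_basis g) (I j) | j < k].

(* The sum runs over all multi-indices and each increasing one is counted k!
   times: the forms e^{i_1} /\ ... /\ e^{i_k}, i_1 < ... < i_k, are
   orthonormal. *)
Definition form_inner (g : W -> W -> R) (k : nat) (a b : k.-tuple W -> R^o) : R :=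
  (k`!%:R)^-1 * \sum_(I : {ffun 'I_k -> 'I_(\dim {:W})})
    (a (basis_tuple g I) * b (basis_tuple g I)).

Definition complex_form_norm (g : W -> W -> R) (k : nat)
    (a : k.-tuple W -> Rcomplex R) : R :=
  Num.sqrt ((k`!%:R)^-1 * \sum_(I : {ffun 'I_k -> 'I_(\dim {:W})})
    (ComplexField.Normc.normc (a (basis_tuple g I))) ^+ 2).

(* ( *a )(v) = < a , vol(., v) >, which is the form *a determined by
   b /\ *a = <b, a> vol for all b of the degree of a. *)
Definition hodge (g : W -> W -> R) (k l : nat)
    (vol : (k + l).-tuple W -> R^o) (a : k.-tuple W -> R^o) :
    l.-tuple W -> R^o :=
  fun v => form_inner g a (fun u => vol [tuple of u ++ v]).

Definition wedge_norm (g : W -> W -> R) (k : nat) (v : k.-tuple W) : R :=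
  Num.sqrt (\det (\matrix_(i < k, j < k) g (tnth v i) (tnth v j))).

Definition is_triple_cross_product (g : W -> W -> R) (X : 3.-tuple W -> W) :=
  [/\ alternating_multilinear X,
      forall (v : 3.-tuple W) (i : 'I_3), g (X v) (tnth v i) = 0
    & forall v : 3.-tuple W, Num.sqrt (g (X v) (X v)) = wedge_norm g v].

Definition compatible_inner_product (Phi : 4.-tuple W -> R^o)
    (g : W -> W -> R) :=
  is_inner_product g /\
  exists2 X : 3.-tuple W -> W,
    (forall (x : W) (v : 3.-tuple W), g x (X v) = Phi [tuple of x :: v])
    & is_triple_cross_product g X.

Definition is_cayley_form (Phi : 4.-tuple W -> R^o) :=
  alternating_multilinear Phi /\ exists g, compatible_inner_product Phi g.

Definition is_positive_cayley_form (Phi : 4.-tuple W -> R^o) :=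
  is_cayley_form Phi /\
  forall u v : W, free [:: u; v] ->
    let b : 2.-tuple W -> R^o := interior v (interior u Phi) in
    same_orientation (wedge Phi Phi) (wedge (wedge b b) Phi).

(* For a positive Cayley form, whose two families of 8-forms induce one and the
   same orientation. *)
Definition compatible_orientation (Phi : 4.-tuple W -> R^o)
    (vol : 8.-tuple W -> R^o) :=
  same_orientation (wedge Phi Phi) vol.

Definition Lambda2_7 (g : W -> W -> R) (vol : 8.-tuple W -> R^o)
    (Phi : 4.-tuple W -> R^o) : set (2.-tuple W -> R^o) :=
  [set tau : 2.-tuple W -> R^o | alternating_multilinear tau /\
     @hodge g 6 2 vol (wedge Phi tau) = 3%:R *: tau].

Definition Lambda2_21 (g : W -> W -> R) (vol : 8.-tuple W -> R^o)
    (Phi : 4.-tuple W -> R^o) : set (2.-tuple W -> R^o) :=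
  [set tau : 2.-tuple W -> R^o | alternating_multilinear tau /\
     @hodge g 6 2 vol (wedge Phi tau) = - tau].

End Metric.

Section ComplexTypes.
Variables (R : realType) (W : vectType R).

(* Multiplication of vectors by complex numbers defined by J. *)
Definition cscale (J : 'End(W)) (z : R[i]) (v : W) : W :=
  (complex.Re z : R) *: v + (complex.Im z : R) *: J v.

Definition complex_multilinear (J : 'End(W)) (k : nat)
    (f : k.-tuple W -> Rcomplex R) :=
  forall (v : k.-tuple W) (i : 'I_k) (z : R[i]) (x y : W),
    f (setslot v i (cscale J z x + y)) =
    (z : Rcomplex R) * f (setslot v i x) + f (setslot v i y).

Definition re_form (k : nat) (f : k.-tuple W -> Rcomplex R) :
    k.-tuple W -> R^o :=
  fun v => complex.Re (f v).

Definition complexify (k : nat) (f : k.-tuple W -> R^o) :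
    k.-tuple W -> Rcomplex R :=
  fun v => (f v)%:C.

Definition Lambda10 (J : 'End(W)) : set (1.-tuple W -> Rcomplex R) :=
  [set a : 1.-tuple W -> Rcomplex R | alternating_multilinear a /\
     forall v : W, a [tuple J v] = (0 +i* 1 : Rcomplex R) * a [tuple v]].

Definition Lambda01 (J : 'End(W)) : set (1.-tuple W -> Rcomplex R) :=
  [set a : 1.-tuple W -> Rcomplex R | alternating_multilinear a /\
     forall v : W, a [tuple J v] = (0 -i* 1 : Rcomplex R) * a [tuple v]].

Definition wedge_span (A B : set (1.-tuple W -> Rcomplex R)) :
    set (2.-tuple W -> Rcomplex R) :=
  [set t | exists (m : nat) (a b : 'I_m -> 1.-tuple W -> Rcomplex R),
     [/\ forall i, A (a i), forall i, B (b i)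
       & t = \sum_(i < m) wedge (a i) (b i)]].

Definition real_Lambda11 (J : 'End(W)) : set (2.-tuple W -> R^o) :=
  [set tau : 2.-tuple W -> R^o | alternating_multilinear tau /\
     wedge_span (Lambda10 J) (Lambda01 J) (complexify tau)].

Definition real_Lambda20_02 (J : 'End(W)) : set (2.-tuple W -> R^o) :=
  [set tau : 2.-tuple W -> R^o | alternating_multilinear tau /\
     exists s t : 2.-tuple W -> Rcomplex R,
     [/\ wedge_span (Lambda10 J) (Lambda10 J) s,
         wedge_span (Lambda01 J) (Lambda01 J) t
       & complexify tau = s + t]].

End ComplexTypes.

Definition is_direct_sum (V : zmodType) (S A B : set V) :=
  S = [set a + b | a in A & b in B] /\ A `&` B = [set 0].

Section SU.
Variables (R : realType) (W : vectType R).

Definition su_metric (Omega : 2.-tuple W -> R^o) (J : 'End(W)) : W -> W -> R :=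
  fun u v => Omega [tuple u; J v].

Record is_SU_structure (n : nat) (Omega : 2.-tuple W -> R^o) (J : 'End(W))
    (Theta : n.-tuple W -> Rcomplex R) : Prop := {
  su_dim : \dim {:W} = (2 * n)%N;
  su_form : alternating_multilinear Omega;
  su_nondegenerate :
    forall u : W, (forall v : W, Omega [tuple u; v] = 0) -> u = 0;
  su_complex_structure : forall v : W, J (J v) = - v;
  su_compatible : is_inner_product (su_metric Omega J);
  su_multilinear : complex_multilinear J Theta;
  su_alternating : alternating Theta;
  su_norm : complex_form_norm (su_metric Omega J) Theta = Num.sqrt (2 ^+ n) }.

Definition su4_volume (Omega : 2.-tuple W -> R^o) : 8.-tuple W -> R^o :=
  24%:R^-1 *: wedge (wedge (wedge Omega Omega) Omega) Omega.

Definition su4_form (Omega : 2.-tuple W -> R^o) (Theta : 4.-tuple W -> Rcomplex R) :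
    4.-tuple W -> R^o :=
  2%:R^-1 *: wedge Omega Omega + re_form Theta.

End SU.

(* Main.v *)
Require Import Defs.
From mathcomp Require Import all_boot all_order all_algebra perm.
From mathcomp Require Import boolp classical_sets functions reals complex.
From mathcomp Require Import ring lra.

Set Implicit Arguments.
Unset Strict Implicit.
Unset Printing Implicit Defensive.

Import Order.TTheory GRing.Theory Num.Theory.
Local Open Scope classical_set_scope.
Local Open Scope ring_scope.

(** The idea is to bring the SU(4)-structure to its standard form and to read
    everything off there.

    An orthonormal frame f_0, ..., f_7 with J f_2k = f_2k+1 and with Theta = 1
    on (f_0, f_2, f_4, f_6) identifies W with C^4, Omega with the standard
    Kaehler form and Theta with dz_0 /\ ... /\ dz_3.  Complex Gram-Schmidt
    produces such frames; the norm of Theta enters in saying that its value on a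
    unitary frame is a phase, which is absorbed in the last frame vector.
    Moreover the frame can be adapted to three given vectors: u in <f_0>,
    v in <f_0, f_1, f_2>, w in <f_0, ..., f_4> ([adapted_su_frame]).

    In a frame, Omega, Re Theta and 2 Phi are integer combinations of wedge
    products of dual 1-forms ([monomial_form]), whose products are given by
    concatenation of words ([wedge_monomial]), their Hodge duals by contraction
    with the volume form ([hodge_combination]), and their values are
    generalized Kronecker deltas ([monomial_word]).  Hence identities between
    them are finite tables of integers.  This gives Phi /\ Phi = 14 vol; with an
    adapted frame, the 8-form of u and v in the definition of positivity is a
    positive multiple of vol ([cayley_positive]), and the norm of the cross
    product is the Gram determinant ([cayley_cross_norm]).

    For the 2-forms, two such tables determine the operator t |-> *(Phi /\ t):
    - *(Omega^2/2 /\ t) = tr(t) Omega - J^* t, where tr is the contraction with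
      Omega ([hodge_kaehler]);
    - *(Re Theta /\ t) is half the contraction of Re Theta with t, because
      Re Theta is self-dual ([hodge_re]).  As Theta is complex multilinear, this
      contraction is J-anti-invariant and vanishes for J-invariant t.
    The real (1,1)-forms are the J-invariant ones and those of type (2,0)+(0,2)
    the J-anti-invariant ones ([real_Lambda11P], [real_Lambda20_02P]).  So the
    eigenvalue equation splits into a J-invariant equation
    tr(t') Omega = (x + 1) t' and an anti-invariant one
    *(Re Theta /\ t'') = (x - 1) t'' ([cayley_eigen]), and the cases x = 3 and
    x = -1 are the two decompositions; tr(t') = 0 means t' /\ Omega^3 = 0 by
    [wedge_cube]. *)

(** * Alternating forms *)

Section Forms.
Variables (R : realType) (W : vectType R).
Implicit Type V : lmodType R.

Lemma tnth_setslot T k (v : k.-tuple T) i x j :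
  tnth (setslot v i x) j = if j == i then x else tnth v j.
Proof. by rewrite tnth_mktuple. Qed.

Lemma setslot_id T k (v : k.-tuple T) i : setslot v i (tnth v i) = v.
Proof.
by apply: eq_from_tnth => j; rewrite tnth_setslot; case: eqP => // ->.
Qed.

Lemma setslot_lshift T p q (u : p.-tuple T) (v : q.-tuple T) i x :
  [tuple of setslot u i x ++ v] = setslot [tuple of u ++ v] (lshift q i) x.
Proof.
apply: eq_from_tnth => j; rewrite tnth_setslot.
case: (split_ordP j) => j' ->.
  by rewrite !tnth_lshift tnth_setslot (inj_eq (@lshift_inj _ _)).
by rewrite !tnth_rshift eq_rlshift.
Qed.

Lemma setslot_rshift T p q (u : p.-tuple T) (v : q.-tuple T) i x :
  [tuple of u ++ setslot v i x] = setslot [tuple of u ++ v] (rshift p i) x.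
Proof.
apply: eq_from_tnth => j; rewrite tnth_setslot.
case: (split_ordP j) => j' ->.
  by rewrite !tnth_lshift eq_lrshift.
by rewrite !tnth_rshift tnth_setslot (inj_eq (@rshift_inj _ _)).
Qed.

Lemma sum_formE V T I (r : seq I) (F : I -> T -> V) v :
  (\sum_(i <- r) F i) v = \sum_(i <- r) F i v.
Proof. by elim: r => [|i r IH]; rewrite ?big_nil // !big_cons -IH. Qed.

Lemma regular_scaleE (a : R) (b : R^o) : a *: b = a * b.
Proof. by []. Qed.

Section Closure.
Variables (V : lmodType R) (k : nat).
Implicit Types f h : k.-tuple W -> V.

Lemma altml0 : alternating_multilinear (0 : k.-tuple W -> V).
Proof.
split=> [v i a x y|//]; change (0 = a *: 0 + 0 :> V).
by rewrite scaler0 addr0.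
Qed.

Lemma altmlD f h : alternating_multilinear f -> alternating_multilinear h ->
  alternating_multilinear (f + h).
Proof.
move=> [fm fa] [hm ha]; split=> [v i a x y|v i j ij e]; rewrite !fctE.
  by rewrite fm hm scalerDr addrACA.
by rewrite (fa v i j) // (ha v i j) // addr0.
Qed.

Lemma altmlZ c f : alternating_multilinear f ->
  alternating_multilinear (c *: f).
Proof.
move=> [fm fa]; split=> [v i a x y|v i j ij e]; rewrite !fctE.
  by rewrite fm scalerDr !scalerA mulrC.
by rewrite (fa v i j) // scaler0.
Qed.

Lemma altml_sum I (r : seq I) (F : I -> k.-tuple W -> V) :
  (forall i, alternating_multilinear (F i)) ->
  alternating_multilinear (\sum_(i <- r) F i).
Proof.
move=> Fa; elim: r => [|i r IH]; first by rewrite big_nil; exact: altml0.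
by rewrite big_cons; apply: altmlD.
Qed.

Lemma multilinear_sum f : multilinear f ->
  forall v i I (r : seq I) (c : I -> R) (x : I -> W),
  f (setslot v i (\sum_(j <- r) c j *: x j)) =
  \sum_(j <- r) c j *: f (setslot v i (x j)).
Proof.
move=> fm v i I r c x; elim: r => [|j r IH].
  have := fm v i (-1) 0 0.
  by rewrite !big_nil scaler0 addr0 scaleN1r addNr.
by rewrite !big_cons fm IH.
Qed.

(** The usual polarization: expand the vanishing value at x + y, x + y. *)
Lemma alternating_tperm f : alternating_multilinear f ->
  forall v i j, i != j -> f [tuple tnth v (tperm i j l) | l < k] = - f v.
Proof.
move=> [fm fa] v i j ij.
pose w a b := setslot (setslot v i a) j b.
have f1 a b x : f (w (a + b) x) = f (w a x) + f (w b x).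
  have wE c : w c x = setslot (setslot v j x) i c.
    apply: eq_from_tnth => l; rewrite !tnth_setslot.
    by case: (eqVneq l i) => [->|//]; rewrite (negPf ij).
  by rewrite !wE -[a in LHS]scale1r fm scale1r.
have f2 a x y : f (w a (x + y)) = f (w a x) + f (w a y).
  by rewrite -[x in LHS]scale1r fm scale1r.
have fd a : f (w a a) = 0.
  by apply: (fa _ i j) => //; rewrite !tnth_setslot !eqxx (negPf ij).
have /eqP := fd (tnth v i + tnth v j).
rewrite f1 // !f2 !fd addr0 add0r addr_eq0 => /eqP E.
have wv : w (tnth v i) (tnth v j) = v.
  apply: eq_from_tnth => l; rewrite !tnth_setslot.
  by case: (eqVneq l j) => [->//|_]; case: (eqVneq l i) => [->|].
rewrite -[in RHS]wv E opprK; congr f; apply: eq_from_tnth => l.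
rewrite tnth_mktuple !tnth_setslot.
case: tpermP => [->|->|]; rewrite ?eqxx ?(negPf ij) //.
by move=> /eqP/negPf -> /eqP/negPf ->.
Qed.

Lemma alternating_perm f : alternating_multilinear f ->
  forall v (s : 'S_k), f [tuple tnth v (s i) | i < k] = (-1) ^+ s *: f v.
Proof.
move=> fa v s; case: (prod_tpermP s) => ts -> /=.
elim: ts v => [|t ts IH] v /=.
  move=> _; rewrite big_nil odd_perm1 scale1r; congr f.
  by apply: eq_from_tnth => i; rewrite tnth_mktuple perm1.
case/andP=> dt dts; rewrite big_cons odd_mul_tperm dt.
pose u := [tuple tnth v ((\prod_(t <- ts) tperm t.1 t.2)%g l) | l < k].
transitivity (f [tuple tnth u (tperm t.1 t.2 i) | i < k]).
  by congr f; apply: eq_from_tnth => i; rewrite !tnth_mktuple permM.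
by rewrite alternating_tperm // IH // signr_addb expr1 mulN1r scaleNr.
Qed.

End Closure.
End Forms.

(** * Expansion in a basis *)

Section Bases.
Variables (R : realType) (W : vectType R).

Lemma altml_catl (V : lmodType R) p q (c : (p + q).-tuple W -> V)
  (w : q.-tuple W) : alternating_multilinear c ->
  alternating_multilinear (fun v : p.-tuple W => c [tuple of v ++ w]).
Proof.
move=> [cm ca]; split=> [v i a x y|v i j ij e].
  by rewrite !setslot_lshift cm.
apply: (ca _ (lshift q i) (lshift q j)); last by rewrite !tnth_lshift.
by rewrite (inj_eq (@lshift_inj _ _)).
Qed.

Lemma altml_catr (V : lmodType R) p q (c : (p + q).-tuple W -> V)
  (w : p.-tuple W) : alternating_multilinear c ->
  alternating_multilinear (fun v : q.-tuple W => c [tuple of w ++ v]).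
Proof.
move=> [cm ca]; split=> [v i a x y|v i j ij e].
  by rewrite !setslot_rshift cm.
apply: (ca _ (rshift p i) (rshift p j)); last by rewrite !tnth_rshift.
by rewrite (inj_eq (@rshift_inj _ _)).
Qed.

Definition word_tuple T k (e : T -> W) (I : 'I_k -> T) : k.-tuple W :=
  [tuple e (I i) | i < k].

Section Expansion.
Variables (T : finType) (e : T -> W) (th : T -> W -> R).
Hypothesis eP : forall x, x = \sum_t th t x *: e t.

(** The basis vectors are substituted one slot at a time: [n] counts the slots
    that still hold arbitrary vectors. *)
Lemma multilinear_ext (V : lmodType R) k (f h : k.-tuple W -> V) :
  multilinear f -> multilinear h ->
  (forall I, f (word_tuple e I) = h (word_tuple e I)) -> f = h.
Proof.
move=> fm hm fh; apply: funext => v.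
suff: forall n v, (forall i : 'I_k, (n <= i)%N -> exists t, tnth v i = e t) ->
  f v = h v.
  by move=> /(_ k v); apply=> i; rewrite leqNgt ltn_ord.
elim=> [|n IH] {}v vP.
  have /fin_all_exists [I vI] : forall i, exists t, tnth v i = e t.
    by move=> i; apply: vP.
  suff -> : v = word_tuple e I by apply: fh.
  by apply: eq_from_tnth => i; rewrite tnth_mktuple.
have [kn|nk] := leqP k n.
  by apply: IH => i ni; have := leq_trans kn ni; rewrite leqNgt ltn_ord.
rewrite -(setslot_id v (Ordinal nk)) [tnth _ _]eP !multilinear_sum //.
apply: eq_bigr => t _; congr (_ *: _); apply: IH => i.
rewrite tnth_setslot; case: eqP => [_ _|ne ni]; first by exists t.
apply: vP; rewrite ltn_neqAle ni andbT; apply/eqP => ni'.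
by apply: ne; apply: val_inj.
Qed.

Hypothesis thl : forall t a x y, th t (a *: x + y) = a * th t x + th t y.
Hypothesis the : forall t s, th t (e s) = (t == s)%:R.

Lemma multilinear_expand (V : lmodType R) k (f : k.-tuple W -> V) v :
  multilinear f ->
  f v = \sum_(I : {ffun 'I_k -> T})
          (\prod_i th (I i) (tnth v i)) *: f (word_tuple e I).
Proof.
move=> fm; pose F v := \sum_(I : {ffun 'I_k -> T})
  (\prod_i th (I i) (tnth v i)) *: f (word_tuple e I).
suff fF : f = F by move/(congr1 (fun h => h v)): fF.
apply: multilinear_ext => // [{}v i a x y|J]; rewrite /F.
  rewrite scaler_sumr -big_split; apply: eq_bigr => I _ /=.
  have slot z : \prod_j th (I j) (tnth (setslot v i z) j) =
      th (I i) z * \prod_(j | j != i) th (I j) (tnth v j).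
    rewrite (bigD1 i) //= tnth_setslot eqxx; congr (_ * _).
    by apply: eq_bigr => j ji; rewrite tnth_setslot (negPf ji).
  by rewrite !slot thl scalerA -scalerDl mulrDl mulrA.
rewrite (bigD1 [ffun i => J i]) //= big1 => [|i _]; last first.
  by rewrite tnth_mktuple the ffunE eqxx.
rewrite scale1r big1 ?addr0 => [|I /eqP IJ].
  by congr f; apply: eq_mktuple => i; rewrite ffunE.
have [i Ii] : exists i, I i != J i.
  apply/existsP; rewrite -negb_forall; apply/negP => /forallP H; apply: IJ.
  by apply/ffunP => i; rewrite ffunE; apply/eqP.
by rewrite (bigD1 i) //= tnth_mktuple the (negPf Ii) mul0r scale0r.
Qed.

End Expansion.

(** Two orthonormal bases compute the same inner product of forms: after
    expanding the second factor in the second basis, the sum over the first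
    basis is the expansion of the first factor. *)
Lemma pairing_basis_indep (T T' : finType) (g : W -> W -> R)
  (e : T -> W) (e' : T' -> W) k (a b : k.-tuple W -> R^o) :
  (forall (c : R) (x y z : W), g (c *: x + y) z = c * g x z + g y z) ->
  (forall x y : W, g x y = g y x) ->
  (forall x, x = \sum_t g (e t) x *: e t) ->
  (forall x, x = \sum_t g (e' t) x *: e' t) ->
  (forall t s, g (e t) (e s) = (t == s)%:R) ->
  (forall t s, g (e' t) (e' s) = (t == s)%:R) ->
  multilinear a -> multilinear b ->
  \sum_(I : {ffun 'I_k -> T}) a (word_tuple e I) * b (word_tuple e I) =
  \sum_(I : {ffun 'I_k -> T'}) a (word_tuple e' I) * b (word_tuple e' I).
Proof.
move=> gl gC eP e'P eo e'o am bm.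
have gr x c y z : g x (c *: y + z) = c * g x y + g x z.
  by rewrite gC gl !(gC x).
transitivity (\sum_(I : {ffun 'I_k -> T}) \sum_(J : {ffun 'I_k -> T'})
   (\prod_i g (e' (J i)) (e (I i))) *
     (a (word_tuple e I) * b (word_tuple e' J))).
  apply: eq_bigr => I _.
  rewrite (multilinear_expand e'P (fun t => gr (e' t)) e'o _ bm) mulr_sumr.
  apply: eq_bigr => J _; rewrite mulrCA; congr (_ * _).
  by apply: eq_bigr => i _; rewrite tnth_mktuple.
rewrite exchange_big; apply: eq_bigr => J _ /=.
rewrite (multilinear_expand eP (fun t => gr (e t)) eo (word_tuple e' J) am).
rewrite mulr_suml; apply: eq_bigr => I _; rewrite mulrA; congr (_ * _ * _).
by apply: eq_bigr => i _; rewrite tnth_mktuple gC.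
Qed.

End Bases.

(** * Wedge products *)

Section Wedge.
Variables (R : realType) (W : vectType R).

Lemma wedge_perm (K : lalgType R) p q (a : p.-tuple W -> K)
  (b : q.-tuple W -> K) v (t : 'S_(p + q)) :
  wedge a b [tuple tnth v (t i) | i < p + q] = (-1) ^+ t *: wedge a b v.
Proof.
rewrite /wedge scalerA mulrC -scalerA; congr (_ *: _).
rewrite scaler_sumr [RHS](reindex_inj (@mulIg _ t)) /=.
apply: eq_bigr => s _; rewrite odd_permM signr_addb.
have -> : [tuple tnth [tuple tnth v (t i) | i < p + q] (s (lshift q i)) | i < p]
    = [tuple tnth v ((s * t)%g (lshift q i)) | i < p].
  by apply: eq_mktuple => i; rewrite tnth_mktuple permM.
have -> : [tuple tnth [tuple tnth v (t i) | i < p + q] (s (rshift p i)) | i < q]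
    = [tuple tnth v ((s * t)%g (rshift p i)) | i < q].
  by apply: eq_mktuple => i; rewrite tnth_mktuple permM.
rewrite -mulrA scaler_sign !mulr_sign.
by case: (odd_perm t); case: (odd_perm s); rewrite ?opprK.
Qed.

Lemma setslot_out k p (f : 'I_p -> 'I_k) (v : k.-tuple W) l x :
  (forall i, f i != l) ->
  [tuple tnth (setslot v l x) (f i) | i < p] = [tuple tnth v (f i) | i < p].
Proof.
by move=> fl; apply: eq_mktuple => i; rewrite tnth_setslot (negPf (fl i)).
Qed.

Lemma setslot_in k p (f : 'I_p -> 'I_k) (v : k.-tuple W) m x :
  injective f ->
  [tuple tnth (setslot v (f m) x) (f i) | i < p] =
  setslot [tuple tnth v (f i) | i < p] m x.
Proof.
move=> fi; apply: eq_mktuple => i.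
by rewrite tnth_setslot tnth_mktuple (inj_eq fi).
Qed.

Lemma altml_wedge p q (a : p.-tuple W -> R^o) (b : q.-tuple W -> R^o) :
  alternating_multilinear a -> alternating_multilinear b ->
  alternating_multilinear (wedge a b).
Proof.
move=> [am _] [bm _]; split=> [v l c x y|v i j ij vij].
  rewrite /wedge scalerA mulrC -scalerA -scalerDr; congr (_ *: _).
  rewrite scaler_sumr -big_split /=; apply: eq_bigr => s _.
  have li : injective (fun i : 'I_p => s (lshift q i)).
    by move=> i j /perm_inj /lshift_inj.
  have ri : injective (fun i : 'I_q => s (rshift p i)).
    by move=> i j /perm_inj /rshift_inj.
  rewrite -(permKV s l); case: (split_ordP ((s^-1)%g l)) => m ->.
    have out i : s (rshift p i) != s (lshift q m).
      by rewrite (inj_eq perm_inj) eq_rlshift.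
    rewrite !(setslot_in v m _ li) !(setslot_out v _ out) am.
    by rewrite mulrDl mulrDr -scalerAl -scalerAr.
  have out i : s (lshift q i) != s (rshift p m).
    by rewrite (inj_eq perm_inj) eq_lrshift.
  rewrite !(setslot_in v m _ ri) !(setslot_out v _ out) bm.
  rewrite mulrDr -scalerAr mulrDr -scalerAr; reflexivity.
have := wedge_perm a b v (tperm i j).
have -> : [tuple tnth v (tperm i j l) | l < p + q] = v.
  apply: eq_from_tnth => l; rewrite tnth_mktuple.
  by case: tpermP => [->|->|] //; rewrite vij.
rewrite odd_tperm ij expr1 scaleN1r => /eqP.
by rewrite -addr_eq0 -mulr2n mulrn_eq0 /= => /eqP.
Qed.

Lemma wedge_suml p q I (r : seq I) (c : I -> R) (a : I -> p.-tuple W -> R^o)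
  (b : q.-tuple W -> R^o) :
  wedge (\sum_(i <- r) c i *: a i) b = \sum_(i <- r) c i *: wedge (a i) b.
Proof.
apply: funext => v; rewrite sum_formE /wedge.
under [RHS]eq_bigr => i _.
  rewrite fctE scalerA mulrC -scalerA scaler_sumr; over.
rewrite -scaler_sumr exchange_big /=; congr (_ *: _); apply: eq_bigr => s _.
rewrite sum_formE mulr_suml mulr_sumr; apply: eq_bigr => i _.
by rewrite fctE -scalerAl -scalerAr.
Qed.

Lemma wedge_sumr p q I (r : seq I) (c : I -> R) (a : p.-tuple W -> R^o)
  (b : I -> q.-tuple W -> R^o) :
  wedge a (\sum_(i <- r) c i *: b i) = \sum_(i <- r) c i *: wedge a (b i).
Proof.
apply: funext => v; rewrite sum_formE /wedge.
under [RHS]eq_bigr => i _.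
  rewrite fctE scalerA mulrC -scalerA scaler_sumr; over.
rewrite -scaler_sumr exchange_big /=; congr (_ *: _); apply: eq_bigr => s _.
rewrite sum_formE mulr_sumr mulr_sumr; apply: eq_bigr => i _.
by rewrite -[RHS]/(c i * _) [RHS]mulrCA; congr (_ * _); rewrite [RHS]mulrCA.
Qed.

Definition word_cat (T : finType) p q (I : {ffun 'I_p -> T})
    (J : {ffun 'I_q -> T}) : {ffun 'I_(p + q) -> T} :=
  [ffun i : 'I_(p + q) =>
     match fintype.split i with inl j => I j | inr j => J j end].

Lemma word_catl (T : finType) p q (I : {ffun 'I_p -> T})
  (J : {ffun 'I_q -> T}) i : word_cat I J (lshift q i) = I i.
Proof. by rewrite ffunE (unsplitK (inl i : 'I_p + 'I_q)%type). Qed.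

Lemma word_catr (T : finType) p q (I : {ffun 'I_p -> T})
  (J : {ffun 'I_q -> T}) i : word_cat I J (rshift p i) = J i.
Proof. by rewrite ffunE (unsplitK (inr i : 'I_p + 'I_q)%type). Qed.

Lemma sum_word_cat (T : finType) p q (F : {ffun 'I_(p + q) -> T} -> R) :
  \sum_I F I = \sum_(I : {ffun 'I_p -> T}) \sum_(J : {ffun 'I_q -> T})
    F (word_cat I J).
Proof.
rewrite pair_big /=.
rewrite (reindex (fun IJ => word_cat IJ.1 IJ.2)) //=.
exists (fun I : {ffun 'I_(p + q) -> T} =>
  ([ffun j : 'I_p => I (lshift q j)], [ffun j : 'I_q => I (rshift p j)]))
  => [[I J] _|I _].
  by congr pair; apply/ffunP => j; rewrite ffunE ?word_catl ?word_catr.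
apply/ffunP => i; case: (split_ordP i) => j ->.
  by rewrite word_catl ffunE.
by rewrite word_catr ffunE.
Qed.

Lemma word_tuple_cat (T : finType) (e : T -> W) p q
  (I : {ffun 'I_p -> T}) (J : {ffun 'I_q -> T}) :
  word_tuple e (word_cat I J) = [tuple of word_tuple e I ++ word_tuple e J].
Proof.
apply: eq_from_tnth => i; rewrite tnth_mktuple.
case: (split_ordP i) => j ->.
  by rewrite word_catl tnth_lshift tnth_mktuple.
by rewrite word_catr tnth_rshift tnth_mktuple.
Qed.

(** Wedging with [a] is adjoint to contracting with [a].  All permutations in
    the definition of the wedge product contribute equally, because the sign of
    a permutation is compensated by the sign it produces in [c]. *)
Lemma pairing_wedge (T : finType) (e : T -> W) p q (a : p.-tuple W -> R^o)
  (b : q.-tuple W -> R^o) (c : (p + q).-tuple W -> R^o) :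
  alternating_multilinear c ->
  (p`! * q`!)%:R * \sum_(I : {ffun 'I_(p + q) -> T})
    wedge a b (word_tuple e I) * c (word_tuple e I) =
  (p + q)`!%:R * \sum_(I : {ffun 'I_p -> T}) \sum_(J : {ffun 'I_q -> T})
    a (word_tuple e I) * b (word_tuple e J) *
    c [tuple of word_tuple e I ++ word_tuple e J].
Proof.
move=> ca.
pose F (I : {ffun 'I_(p + q) -> T}) : R :=
  a [tuple e (I (lshift q i)) | i < p] * b [tuple e (I (rshift p i)) | i < q]
  * c (word_tuple e I).
have F0 : \sum_(I : {ffun 'I_(p + q) -> T}) F I =
    \sum_(I : {ffun 'I_p -> T}) \sum_(J : {ffun 'I_q -> T})
    a (word_tuple e I) * b (word_tuple e J) *
    c [tuple of word_tuple e I ++ word_tuple e J].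
  rewrite sum_word_cat; apply: eq_bigr => I _; apply: eq_bigr => J _.
  rewrite /F word_tuple_cat; congr (a _ * b _ * _); apply: eq_mktuple => i.
    by rewrite word_catl.
  by rewrite word_catr.
rewrite -F0 mulr_sumr.
transitivity (\sum_(s : 'S_(p + q)) \sum_I F I); last first.
  by rewrite sumr_const card_Sn mulr_natl.
transitivity (\sum_(s : 'S_(p + q)) \sum_(I : {ffun 'I_(p + q) -> T})
   F [ffun i => I (s i)]).
  rewrite exchange_big; apply: eq_bigr => I _ /=.
  rewrite /wedge -[_ *: _]/(_ * _) mulrA mulrA divff; last first.
    by rewrite pnatr_eq0 muln_eq0 negb_or -!lt0n !fact_gt0.
  rewrite mul1r mulr_suml; apply: eq_bigr => s _.
  have -> : c (word_tuple e I) =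
      (-1) ^+ s * c (word_tuple e [ffun i => I (s i)]).
    have := alternating_perm ca (word_tuple e I) s.
    rewrite -[_ *: _]/(_ * _).
    have -> : [tuple tnth (word_tuple e I) (s i) | i < p + q] =
       word_tuple e [ffun i => I (s i)].
      by apply: eq_mktuple => i; rewrite tnth_mktuple ffunE.
    by move=> ->; rewrite mulrA -signr_addb addbb mul1r.
  rewrite /F mulrACA -signr_addb addbb mul1r; congr (a _ * b _ * _);
    by apply: eq_mktuple => i; rewrite ?ffunE ?tnth_mktuple.
apply: eq_bigr => s _.
rewrite [RHS](reindex (fun I : {ffun 'I_(p + q) -> T} =>
  [ffun i => I (s i)] : {ffun 'I_(p + q) -> T})) //.
exists (fun I : {ffun 'I_(p + q) -> T} =>
  [ffun i => I ((s^-1)%g i)] : {ffun 'I_(p + q) -> T}) => I _;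
  by apply/ffunP => i; rewrite !ffunE ?permK ?permKV.
Qed.

End Wedge.

(** * Monomial forms of an orthonormal frame *)

Definition delete_nth (i : nat) (K : seq nat) := take i K ++ drop i.+1 K.

(** The generalized Kronecker delta of two words: the determinant of the matrix
    with entries 1 where letters agree, by expansion along the first letter of
    [L].  In this form it evaluates on concrete words. *)
Fixpoint word_delta (L K : seq nat) : int :=
  if L is l :: L' then
    foldr +%R 0 [seq if nth 0%N K i == l then
                       let d := word_delta L' (delete_nth i K) in
                       if odd i then - d else d
                     else 0 | i <- iota 0%N (size K)]
  else 1.

Lemma nth_delete i K x : (i < size K)%N ->
  nth 0%N (delete_nth i K) x = nth 0%N K (bump i x).
Proof.
move=> iK; rewrite nth_cat size_take iK /bump.
case: ltnP => [xi|ix] /=; first by rewrite nth_take ?add0n.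
by rewrite nth_drop addSn subnKC.
Qed.

Lemma size_delete i K : (i < size K)%N -> size (delete_nth i K) = (size K).-1.
Proof.
move=> iK; rewrite size_cat size_take iK size_drop.
by case: (size K) iK => // n; rewrite ltnS subSS => /subnKC.
Qed.

Lemma det_delta (R : comNzRingType) k L K : size L = k -> size K = k ->
  \det (\matrix_(i < k, j < k) (nth 0%N L j == nth 0%N K i)%:R : 'M[R]_k) =
  (word_delta L K)%:~R.
Proof.
elim: L k K => [|l L IH] [|k] K //= => [_ _|[sL] sK].
  by rewrite det_mx00.
rewrite foldrE big_map (expand_det_col _ ord0) rmorph_sum /=.
have -> : iota 0%N (size K) = index_iota 0%N k.+1.
  by rewrite sK /index_iota subn0.
rewrite big_mkord; apply: eq_bigr => i _; rewrite !mxE /= eq_sym.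
case: eqP => [il|_]; last by rewrite mul0r.
have iK : (i < size K)%N by rewrite sK.
rewrite mul1r /cofactor addn0.
have -> : row' i (col' ord0 (\matrix_(i, j)
      (nth 0%N (l :: L) j == nth 0%N K i)%:R)) =
    \matrix_(i', j) (nth 0%N L j == nth 0%N (delete_nth i K) i')%:R :> 'M[R]_k.
  by apply/matrixP => a b; rewrite !mxE nth_delete.
rewrite IH ?size_delete ?sK // -signr_odd mulr_sign.
by case: (odd i); rewrite ?rmorphN.
Qed.

Section FrameDefinitions.
Variables (R : realType) (W : vectType R).

(** Frames are indexed by natural numbers, of which only the first [m] matter:
    words are then plain lists of numbers, with which one can compute. *)
Record orthonormal_frame (g : W -> W -> R) (m : nat) (f : nat -> W) : Prop := {
  frame_inner : is_inner_product g;
  frame_orth : forall i j, (i < m)%N -> (j < m)%N ->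
    g (f i) (f j) = (i == j)%:R;
  frame_expand : forall x, x = \sum_(i < m) g (f i) x *: f i }.

Definition word (f : nat -> W) k (K : seq nat) : k.-tuple W :=
  word_tuple f (fun i : 'I_k => nth 0%N K i).

(** The wedge product of the 1-forms dual to the frame vectors listed in [L]. *)
Definition monomial_form (g : W -> W -> R) (f : nat -> W) k (L : seq nat) :
    k.-tuple W -> R^o :=
  fun v => \det (\matrix_(i < k, j < k) g (f (nth 0%N L j)) (tnth v i)).

End FrameDefinitions.
Arguments word {R W} f k K.
Arguments monomial_form {R W} g f k L v.

Section Frame.
Variables (R : realType) (W : vectType R).

Lemma word_cons (f : nat -> W) k x K :
  [tuple of f x :: word f k K] = word f k.+1 (x :: K).
Proof.
apply: eq_from_tnth => i; rewrite !(tnth_nth 0%R) /=.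
have -> : [seq f (nth 0%N (x :: K) (i : 'I_k.+1)) | i <- enum 'I_k.+1] =
  f x :: [seq f (nth 0%N K (i : 'I_k)) | i <- enum 'I_k]; last by [].
rewrite enum_ordSl /= -map_comp; congr (_ :: _).
Qed.

Variables (g : W -> W -> R) (m : nat) (f : nat -> W).
Hypothesis F : orthonormal_frame g m f.
Let gl := let: And3 h _ _ := frame_inner F in h.
Let gC := let: And3 _ h _ := frame_inner F in h.

Lemma inner_linr x c y z : g x (c *: y + z) = c * g x y + g x z.
Proof. by rewrite gC gl !(gC x). Qed.

Lemma form_ext (V : lmodType R) k (a b : k.-tuple W -> V) :
  alternating_multilinear a -> alternating_multilinear b ->
  (forall K, size K = k -> all (gtn m) K -> a (word f k K) = b (word f k K)) ->
  a = b.
Proof.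
move=> [am _] [bm _] ab.
apply: (@multilinear_ext _ _ _ (fun i : 'I_m => f i) (fun i => g (f i))) => //.
  exact: frame_expand F.
move=> I; have := ab [seq val (I i) | i <- enum 'I_k].
have -> : word f k [seq val (I i) | i <- enum 'I_k] =
  word_tuple (fun i : 'I_m => f i) I.
  apply: eq_mktuple => i.
  by rewrite (nth_map i) ?nth_ord_enum // size_enum_ord.
apply; first by rewrite size_map size_enum_ord.
by apply/allP => _ /mapP [i _ ->] /=.
Qed.

Lemma altml_monomial k L : alternating_multilinear (monomial_form g f k L).
Proof.
split=> [v i c x y|v i j ij vij].
  transitivity (c * monomial_form g f k L (setslot v i x) +
    1 * monomial_form g f k L (setslot v i y)); last by rewrite mul1r.
  apply: (@determinant_multilinear _ _ _ _ _ i).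
  - by apply/rowP => j; rewrite !mxE !tnth_setslot eqxx inner_linr mul1r.
  - by apply/matrixP => a b; rewrite !mxE !tnth_setslot lift_eqF.
  - by apply/matrixP => a b; rewrite !mxE !tnth_setslot lift_eqF.
by apply: (determinant_alternate ij) => l; rewrite !mxE vij.
Qed.

Lemma monomial_word k L K : size L = k -> size K = k ->
  all (gtn m) L -> all (gtn m) K ->
  monomial_form g f k L (word f k K) = (word_delta L K)%:~R.
Proof.
move=> sL sK /all_nthP Lm /all_nthP Km; rewrite -(det_delta _ sL sK).
congr (\det _); apply/matrixP => i j.
rewrite !mxE tnth_mktuple (frame_orth F) //.
  by apply: Lm; rewrite sL.
by apply: Km; rewrite sK.
Qed.

(** Pairing with a monomial form is evaluation at its word: expanding the
    determinant, only the rearrangements of [L] contribute, all of them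
    equally. *)
Lemma pairing_monomial k L (c : k.-tuple W -> R^o) :
  alternating_multilinear c -> size L = k -> all (gtn m) L ->
  \sum_(I : {ffun 'I_k -> 'I_m})
    monomial_form g f k L (word_tuple (fun i : 'I_m => f i) I) *
      c (word_tuple (fun i : 'I_m => f i) I) =
  k`!%:R * c (word f k L).
Proof.
move=> ca sL /all_nthP Lm.
have Li (i : 'I_k) : (nth 0%N L i < m)%N by apply: Lm; rewrite sL.
transitivity (\sum_(s : 'S_k) c (word f k L)); last first.
  by rewrite sumr_const card_Sn mulr_natl.
transitivity (\sum_(I : {ffun 'I_k -> 'I_m}) \sum_(s : 'S_k)
  (-1) ^+ s * ((\prod_i (nth 0%N L (s i) == I i)%:R) *
     c (word_tuple (fun i : 'I_m => f i) I))).
  apply: eq_bigr => I _; rewrite mulr_suml; apply: eq_bigr => s _.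
  rewrite mulrA; congr (_ * _ * _); apply: eq_bigr => i _.
  by rewrite !mxE tnth_mktuple (frame_orth F).
rewrite exchange_big; apply: eq_bigr => s _ /=.
pose I0 : {ffun 'I_k -> 'I_m} := [ffun i => Ordinal (Li (s i))].
rewrite (bigD1 I0) //= [X in _ + X]big1 ?addr0 => [|I /eqP II0]; last first.
  have [i Ii] : exists i, I i != I0 i.
    apply/existsP; rewrite -negb_forall; apply/negP => /forallP H; apply: II0.
    by apply/ffunP => i; apply/eqP.
  rewrite (bigD1 i) //=; have -> : (nth 0%N L (s i) == I i) = false.
    by apply/negbTE; apply: contra Ii; rewrite ffunE -val_eqE eq_sym.
  by rewrite !mul0r mulr0.
rewrite big1 => [|i _]; last by rewrite ffunE eqxx.
rewrite mul1r; have := alternating_perm ca (word f k L) s.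
have -> : [tuple tnth (word f k L) (s i) | i < k] =
  word_tuple (fun i : 'I_m => f i) I0.
  by apply: eq_mktuple => i; rewrite tnth_mktuple ffunE.
by move=> ->; rewrite -[_ *: _]/(_ * _) mulrA -signr_addb addbb mul1r.
Qed.

Lemma word_cat_seq p q L M : size L = p -> size M = q ->
  [tuple of word f p L ++ word f q M] = word f (p + q) (L ++ M).
Proof.
move=> sL sM; apply: eq_from_tnth => i; rewrite tnth_mktuple nth_cat sL.
case: (split_ordP i) => j ->.
  by rewrite tnth_lshift tnth_mktuple.
by rewrite tnth_rshift tnth_mktuple /= addKn.
Qed.

Lemma monomialC k L K : size L = k -> size K = k ->
  all (gtn m) L -> all (gtn m) K ->
  monomial_form g f k L (word f k K) = monomial_form g f k K (word f k L).
Proof.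
move=> sL sK /all_nthP Lm /all_nthP Km; rewrite -[RHS]det_tr; congr (\det _).
by apply/matrixP => i j; rewrite !mxE !tnth_mktuple gC.
Qed.

(** By adjunction both sides have the same pairing with every
    [monomial_form K], and these pairings are the values at [word K]. *)
Lemma wedge_monomial p q L M : size L = p -> size M = q ->
  all (gtn m) L -> all (gtn m) M ->
  wedge (monomial_form g f p L) (monomial_form g f q M) =
  monomial_form g f (p + q) (L ++ M).
Proof.
move=> sL sM Lm Mm; have aK k K := altml_monomial k K.
have aw : alternating_multilinear
  (wedge (monomial_form g f p L) (monomial_form g f q M)) by apply: altml_wedge.
apply: form_ext => // K sK Km.
set a := monomial_form g f p L; set b := monomial_form g f q M.
pose c := monomial_form g f (p + q) K; pose e (i : 'I_m) := f i.
have sumJ (I : {ffun 'I_p -> 'I_m}) :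
    \sum_(J : {ffun 'I_q -> 'I_m}) b (word_tuple e J) *
      c [tuple of word_tuple e I ++ word_tuple e J] =
    q`!%:R * c [tuple of word_tuple e I ++ word f q M].
  by rewrite -(pairing_monomial (altml_catr _ (aK _ K)) sM Mm).
have sumI :
    \sum_(I : {ffun 'I_p -> 'I_m}) a (word_tuple e I) *
      c [tuple of word_tuple e I ++ word f q M] =
    p`!%:R * c [tuple of word f p L ++ word f q M].
  by rewrite -(pairing_monomial (altml_catl _ (aK _ K)) sL Lm).
have := pairing_wedge e a b (aK (p + q)%N K).
under eq_bigr do rewrite mulrC.
rewrite pairing_monomial //.
under [in RHS]eq_bigr => I _.
  under eq_bigr do rewrite -mulrA.
  rewrite -mulr_sumr sumJ mulrCA; over.
rewrite -mulr_sumr sumI word_cat_seq // /c monomialC ?size_cat ?sL ?sM //;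
  last by rewrite all_cat Lm.
have n0 k : k`!%:R != 0 :> R by rewrite pnatr_eq0 -lt0n fact_gt0.
(* Cancel the factorials. *)
rewrite mulrCA => /(mulfI (n0 _)); rewrite natrM mulrA (mulrC q`!%:R) => /mulfI.
by apply; rewrite mulf_neq0.
Qed.

End Frame.

(** * Integer combinations of monomial forms, and the Hodge operator *)

Section Combinations.

(** A pair of a coefficient and a word stands for a multiple of a monomial form.
    Words need be neither sorted nor distinct, so that the wedge product is
    concatenation of words and all signs are left to [word_delta]. *)
Definition word_combination := seq (int * seq nat).

Definition homogeneous (m k : nat) (l : word_combination) :=
  all (fun x => (size x.2 == k) && all (gtn m) x.2) l.

Definition combination_mul (l l' : word_combination) : word_combination :=
  [seq (x.1 * y.1, x.2 ++ y.2) | x <- l, y <- l'].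

Definition combination_eval (l : word_combination) (K : seq nat) : int :=
  foldr +%R 0 [seq x.1 * word_delta x.2 K | x <- l].

Lemma homogeneous_mul m p q l l' : homogeneous m p l -> homogeneous m q l' ->
  homogeneous m (p + q) (combination_mul l l').
Proof.
move=> /allP lP /allP lP'; apply/allP => _ /allpairsP [[x y] [xl yl ->]] /=.
have /andP [/eqP sx mx] := lP x xl; have /andP [/eqP sy my] := lP' y yl.
by rewrite size_cat sx sy eqxx all_cat mx my.
Qed.

Variables (R : realType) (W : vectType R).

Definition combination_form (g : W -> W -> R) (f : nat -> W) k
    (l : word_combination) : k.-tuple W -> R^o :=
  \sum_(x <- l) (x.1%:~R : R) *: monomial_form g f k x.2.

End Combinations.
Arguments combination_form {R W} g f k l.

(** The letters of [K] index the vectors of [h]: an alternating form of degree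
    [k] on [k] vectors has only one independent value. *)
Lemma alternating_word (R : realType) (W : vectType R) (V : lmodType R) k
  (h : nat -> W) (c : k.-tuple W -> V) K :
  alternating_multilinear c -> size K = k -> all (gtn k) K ->
  c (word h k K) =
  ((word_delta (iota 0%N k) K)%:~R : R) *: c (word h k (iota 0%N k)).
Proof.
move=> ca sK /all_nthP Kk; rewrite -(@det_delta R k) ?size_iota //.
have Ki (i : 'I_k) : (nth 0%N K i < k)%N by apply: Kk; rewrite sK.
case: (boolP (uniq K)) => [uK|/(uniqPn 0%N) [i [j [ij jK Kij]]]]; last first.
  rewrite sK in jK; have iK := ltn_trans ij jK.
  have ne : Ordinal iK != Ordinal jK by rewrite -val_eqE neq_ltn /= ij.
  rewrite (determinant_alternate ne) => [|l]; last by rewrite !mxE /= Kij.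
  by case: ca => _ /(_ _ _ _ ne) ->; rewrite ?scale0r // !tnth_mktuple /= Kij.
have si : injective (fun i : 'I_k => Ordinal (Ki i)).
  move=> i j /(congr1 val) /= /eqP; rewrite nth_uniq ?sK // => /eqP.
  exact: val_inj.
have -> : \matrix_(i < k, j < k) (nth 0%N (iota 0%N k) j == nth 0%N K i)%:R =
    perm_mx (perm si) :> 'M[R]_k.
  apply/matrixP => i j; rewrite !mxE permE nth_iota // add0n eq_sym.
  by rewrite -val_eqE.
rewrite det_perm -alternating_perm //; congr c; apply: eq_mktuple => i.
by rewrite tnth_mktuple permE /= nth_iota.
Qed.

Lemma orthonormal_basis_expand (R : realType) (W : vectType R)
  (g : W -> W -> R) (e : (\dim {:W}).-tuple W) :
  is_inner_product g ->
  is_orthonormal_basis g e -> forall x, x = \sum_i g (tnth e i) x *: tnth e i.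
Proof.
move=> [gl gC _] [eb eo] x.
rewrite {1}(coord_basis eb (memvf x)); apply: eq_bigr => i _.
rewrite -tnth_nth; congr (_ *: _).
rewrite [in RHS](coord_basis eb (memvf x)) gC.
have g_sum (I : Type) (r : seq I) (c : I -> R) (y : I -> W) z :
    g (\sum_(j <- r) c j *: y j) z = \sum_(j <- r) c j * g (y j) z.
  elim: r => [|j r IH]; last by rewrite !big_cons gl IH.
  have := gl (-1) 0 0 z.
  by rewrite !big_nil scaler0 addr0 mulN1r addNr.
rewrite g_sum (bigD1 i) //= -tnth_nth eo eqxx mulr1 big1 ?addr0 // => j ji.
by rewrite -tnth_nth eo (negPf ji) mulr0.
Qed.

Lemma form_inner_lin (R : realType) (W : vectType R) (g : W -> W -> R) k I
  (r : seq I) (x : I -> R) (a : I -> k.-tuple W -> R^o) c :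
  form_inner g (\sum_(i <- r) x i *: a i) c =
  \sum_(i <- r) x i * form_inner g (a i) c.
Proof.
rewrite /form_inner; under [RHS]eq_bigr do rewrite mulrCA mulr_sumr.
rewrite -mulr_sumr exchange_big /=; congr (_ * _); apply: eq_bigr => K _.
rewrite sum_formE mulr_suml; apply: eq_bigr => i _.
by rewrite fctE -[_ *: _]/(_ * _) mulrA.
Qed.

Section FrameForms.
Variables (R : realType) (W : vectType R).
Variables (g : W -> W -> R) (m : nat) (f : nat -> W).
Hypothesis F : orthonormal_frame g m f.

Lemma altml_combination k l :
  alternating_multilinear (combination_form g f k l).
Proof.
by apply: altml_sum => x; apply: altmlZ; apply: altml_monomial; exact: F.
Qed.

Lemma combination_word k l K : homogeneous m k l -> size K = k ->
  all (gtn m) K ->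
  combination_form g f k l (word f k K) = (combination_eval l K)%:~R.
Proof.
move=> /allP lk sK Km; rewrite /combination_form sum_formE /combination_eval.
rewrite foldrE big_map rmorph_sum /= !big_seq; apply: eq_bigr => x xl.
have /andP [/eqP sx mx] := lk x xl.
by rewrite fctE (monomial_word F) // rmorphM.
Qed.

Lemma wedge_combination p q l l' : homogeneous m p l -> homogeneous m q l' ->
  wedge (combination_form g f p l) (combination_form g f q l') =
  combination_form g f (p + q) (combination_mul l l').
Proof.
move=> /allP lP /allP lP'; rewrite /combination_form wedge_suml.
rewrite big_allpairs_dep /= big_seq [RHS]big_seq; apply: eq_bigr => x xl.
have /andP [/eqP sx mx] := lP x xl.
rewrite wedge_sumr scaler_sumr big_seq [RHS]big_seq; apply: eq_bigr => y yl.
have /andP [/eqP sy my] := lP' y yl.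
by rewrite (wedge_monomial F) // scalerA rmorphM.
Qed.

Definition volume_form := monomial_form g f m (iota 0%N m).

Lemma volume_word_iota : volume_form (word f m (iota 0%N m)) = 1.
Proof.
rewrite /volume_form /monomial_form -[RHS](det1 R m); congr (\det _).
apply/matrixP => i j; rewrite !mxE tnth_mktuple !nth_iota // !add0n.
by rewrite (frame_orth F) // eq_sym.
Qed.

Lemma top_form (c : m.-tuple W -> R^o) : alternating_multilinear c ->
  c = c (word f m (iota 0%N m)) *: volume_form.
Proof.
move=> ca; have va := altml_monomial F m (iota 0%N m).
have i_m : all (gtn m) (iota 0%N m) by apply/allP => i; rewrite mem_iota.
apply: (form_ext F) => //; first by apply: altmlZ.
move=> K sK Km; rewrite -[RHS]/(_ * volume_form (word f m K)).
rewrite (alternating_word f ca sK Km) /volume_form (monomial_word F) //.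
  by rewrite mulrC.
by rewrite size_iota.
Qed.

Lemma combination_top l : homogeneous m m l ->
  combination_form g f m l =
  ((combination_eval l (iota 0%N m))%:~R : R) *: volume_form.
Proof.
move=> lm; rewrite [LHS]top_form; last exact: altml_combination.
rewrite combination_word ?size_iota //.
by apply/allP => i; rewrite mem_iota.
Qed.

Lemma orthonormal_basis_frame : \dim {:W} = m ->
  is_orthonormal_basis g (orthonormal_basis g).
Proof.
move=> dW; apply: xgetPex; exists [tuple f i | i < \dim {:W}].
split=> [|i j]; last first.
  by rewrite !tnth_mktuple (frame_orth F) // -dW.
rewrite basisEdim size_tuple leqnn andbT; apply/subvP => x _.
rewrite (frame_expand F x); apply: memv_suml => i _; apply: memvZ.
apply: memv_span; have iW : (i < \dim {:W})%N by rewrite dW.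
by apply/tnthP; exists (Ordinal iW); rewrite tnth_mktuple.
Qed.

(** The inner product of forms is defined with a basis chosen arbitrarily; any
    frame computes it. *)
Lemma form_inner_frame k (a b : k.-tuple W -> R^o) : \dim {:W} = m ->
  alternating_multilinear a -> alternating_multilinear b ->
  form_inner g a b = (k`!%:R)^-1 * \sum_(I : {ffun 'I_k -> 'I_m})
    a (word_tuple (fun i : 'I_m => f i) I) *
    b (word_tuple (fun i : 'I_m => f i) I).
Proof.
move=> dW [am _] [bm _]; have ob := orthonormal_basis_frame dW.
have [gl gC _] := frame_inner F.
rewrite /form_inner; congr (_ * _).
apply: (pairing_basis_indep (g := g) (e := tnth (orthonormal_basis g))
  (e' := fun i : 'I_m => f i)) => //.
- by apply: orthonormal_basis_expand => //; exact: frame_inner F.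
- exact: frame_expand F.
- by case: ob.
- by move=> i j; rewrite (frame_orth F).
Qed.

Lemma form_inner_combination k l (c : k.-tuple W -> R^o) :
  \dim {:W} = m -> alternating_multilinear c -> homogeneous m k l ->
  form_inner g (combination_form g f k l) c =
  \sum_(x <- l) x.1%:~R * c (word f k x.2).
Proof.
move=> dW ca /allP lk; rewrite (form_inner_frame dW (altml_combination k l) ca).
rewrite /combination_form.
under eq_bigr do rewrite sum_formE mulr_suml.
rewrite exchange_big /= mulr_sumr !big_seq; apply: eq_bigr => x xl.
have /andP [/eqP sx mx] := lk x xl.
under eq_bigr do rewrite fctE -[_ *: _]/(_ * _) -mulrA.
rewrite -mulr_sumr (pairing_monomial F ca) // mulrCA; congr (_ * _).
by rewrite mulrA mulVf ?mul1r // pnatr_eq0 -lt0n fact_gt0.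
Qed.

(** The Hodge operator turns monomials into contractions of the volume form. *)
Lemma hodge_combination k n l (vol : (k + n).-tuple W -> R^o) v :
  \dim {:W} = m -> alternating_multilinear vol -> homogeneous m k l ->
  hodge g vol (combination_form g f k l) v =
  \sum_(x <- l) x.1%:~R * vol [tuple of word f k x.2 ++ v].
Proof.
by move=> dW va lk; apply: form_inner_combination => //; apply: altml_catl.
Qed.

End FrameForms.
Arguments volume_form {R W} g m f v.

(** * Real 2-forms and their types *)

Section TwoForms.
Variables (R : realType) (W : vectType R).

Lemma tuple2E T (v : 2.-tuple T) : v = [tuple tnth v 0; tnth v 1].
Proof.
apply: eq_from_tnth => i; rewrite [RHS](tnth_nth (tnth v 0)).
by case: i => [[|[|//]] ?] /=; congr tnth; apply: val_inj.
Qed.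

Section TwoForm.
Variable t : 2.-tuple W -> R^o.
Hypothesis ta : alternating_multilinear t.

Let slot0 x y z : setslot [tuple x; y] 0 z = [tuple z; y] :> 2.-tuple W.
Proof. by rewrite [LHS]tuple2E !tnth_setslot. Qed.

Let slot1 x y z : setslot [tuple x; y] 1 z = [tuple x; z] :> 2.-tuple W.
Proof. by rewrite [LHS]tuple2E !tnth_setslot. Qed.

Lemma form2_linl c x y z :
  t [tuple c *: x + y; z] = c * t [tuple x; z] + t [tuple y; z].
Proof. by have [/(_ [tuple 0; z] 0 c x y)] := ta; rewrite !slot0. Qed.

Lemma form2_linr c x y z :
  t [tuple z; c *: x + y] = c * t [tuple z; x] + t [tuple z; y].
Proof. by have [/(_ [tuple z; 0] 1 c x y)] := ta; rewrite !slot1. Qed.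

Lemma form2_suml I (r : seq I) (c : I -> R) (x : I -> W) z :
  t [tuple \sum_(i <- r) c i *: x i; z] = \sum_(i <- r) c i * t [tuple x i; z].
Proof.
have [/multilinear_sum h _] := ta; have := h [tuple 0; z] 0 _ r c x.
by rewrite slot0 => ->; apply: eq_bigr => i _; rewrite slot0.
Qed.

Lemma form2_sumr I (r : seq I) (c : I -> R) (x : I -> W) z :
  t [tuple z; \sum_(i <- r) c i *: x i] = \sum_(i <- r) c i * t [tuple z; x i].
Proof.
have [/multilinear_sum h _] := ta; have := h [tuple z; 0] 1 _ r c x.
by rewrite slot1 => ->; apply: eq_bigr => i _; rewrite slot1.
Qed.

Lemma form2C x y : t [tuple x; y] = - t [tuple y; x].
Proof.
rewrite -(alternating_tperm ta [tuple y; x] (isT : 0 != 1 :> 'I_2)).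
by congr t; rewrite [RHS]tuple2E !tnth_mktuple tpermL tpermR.
Qed.

Lemma form2Nl x y : t [tuple - x; y] = - t [tuple x; y].
Proof.
have := form2_linl (-1) x 0 y; have := form2_linl (-1) 0 0 y.
by rewrite scaler0 !addr0 mulN1r addNr => ->; rewrite scaleN1r mulN1r addr0.
Qed.

Lemma form2Nr x y : t [tuple x; - y] = - t [tuple x; y].
Proof. by rewrite form2C form2Nl form2C opprK. Qed.

End TwoForm.

Definition J_invariant (J : 'End(W)) (t : 2.-tuple W -> R^o) :=
  forall x y, t [tuple J x; J y] = t [tuple x; y].

Definition J_anti_invariant (J : 'End(W)) (t : 2.-tuple W -> R^o) :=
  forall x y, t [tuple J x; J y] = - t [tuple x; y].

Lemma perm_two (s : 'S_2) : s = 1%g \/ s = tperm 0 1.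
Proof.
have [s0|s0] := eqVneq (s 0) 0; [left|right]; apply/permP => i.
  rewrite perm1; case: i => [[|[|//]] i1].
    by rewrite (_ : Ordinal i1 = 0) ?s0 //; apply: val_inj.
  rewrite (_ : Ordinal i1 = 1); last exact: val_inj.
  have : s 1 != s 0 by rewrite (inj_eq perm_inj).
  by rewrite s0; case: (s 1) => [[|[|//]] j] //= _; apply: val_inj.
have s0' : s 0 = 1.
  by case: (s 0) s0 => [[|[|//]] j] //= _; apply: val_inj.
case: i => [[|[|//]] i1].
  by rewrite (_ : Ordinal i1 = 0) ?tpermL //; apply: val_inj.
rewrite (_ : Ordinal i1 = 1) ?tpermR; last exact: val_inj.
have : s 1 != s 0 by rewrite (inj_eq perm_inj).
by rewrite s0'; case: (s 1) => [[|[|//]] j] //= _; apply: val_inj.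
Qed.

Lemma wedge_one_forms (K : lalgType R) (a b : 1.-tuple W -> K) x y :
  wedge a b [tuple x; y] =
  a [tuple x] * b [tuple y] - a [tuple y] * b [tuple x].
Proof.
rewrite /wedge invr1 scale1r (bigD1 (1%g : 'S_2)) //=.
rewrite (bigD1 (tperm 0 1 : 'S_2)) /=; last first.
  by apply/eqP => /permP /(_ 0); rewrite tpermL perm1.
rewrite big1 ?addr0 => [|s]; last first.
  by case/andP=> /eqP s1 /eqP s2; case: (perm_two s).
rewrite odd_perm1 mul1r odd_tperm /= expr1 mulN1r.
have l0 : lshift 1 (ord0 : 'I_1) = 0 by exact: val_inj.
have r0 : rshift 1 (ord0 : 'I_1) = 1 by exact: val_inj.
have m1 (h : 'I_1 -> W) : [tuple h i | i < 1] = [tuple h ord0].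
  by apply: eq_from_tnth => i; rewrite ord1 tnth_mktuple.
by rewrite !m1 !l0 !r0 !perm1 tpermL tpermR.
Qed.

End TwoForms.

Section Types.
Local Open Scope complex_scope.
Variables (R : realType) (W : vectType R) (J : 'End(W)).
Hypothesis JJ : forall v, J (J v) = - v.

(** Twice the (1,0)-part of a real linear form. *)
Definition form10 (phi : W -> R) : 1.-tuple W -> Rcomplex R :=
  fun v => phi (tnth v 0) +i* - phi (J (tnth v 0)).

(** Twice the (0,1)-part of a real linear form. *)
Definition form01 (phi : W -> R) : 1.-tuple W -> Rcomplex R :=
  fun v => phi (tnth v 0) +i* phi (J (tnth v 0)).

Lemma form10P (phi : W -> R) :
  (forall c x y, phi (c *: x + y) = c * phi x + phi y) ->
  Lambda10 J (form10 phi).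
Proof.
move=> pl; have pN x : phi (- x) = - phi x.
  have := pl (-1) x 0; have := pl (-1) 0 0.
  by rewrite scaler0 !addr0 mulN1r addNr => ->; rewrite scaleN1r mulN1r addr0.
split; first (split=> [v i c x y|v i j]; last by rewrite (ord1 i) (ord1 j)).
  rewrite /form10 (ord1 i) !tnth_setslot eqxx linearP !pl; simpc.
  by apply/eqP; rewrite eq_complex /= !eqxx.
have t0 x : tnth [tuple x] 0 = x :> W by [].
move=> v; rewrite /form10 !t0 JJ pN opprK; apply/eqP; rewrite eq_complex /=.
by rewrite !mul0r !mul1r sub0r opprK add0r !eqxx.
Qed.

Lemma form01P (phi : W -> R) :
  (forall c x y, phi (c *: x + y) = c * phi x + phi y) ->
  Lambda01 J (form01 phi).
Proof.
move=> pl; have pN x : phi (- x) = - phi x.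
  have := pl (-1) x 0; have := pl (-1) 0 0.
  by rewrite scaler0 !addr0 mulN1r addNr => ->; rewrite scaleN1r mulN1r addr0.
split; first (split=> [v i c x y|v i j]; last by rewrite (ord1 i) (ord1 j)).
  rewrite /form01 (ord1 i) !tnth_setslot eqxx linearP !pl; simpc.
  by apply/eqP; rewrite eq_complex /= !eqxx.
have t0 x : tnth [tuple x] 0 = x :> W by [].
move=> v; rewrite /form01 !t0 JJ pN; apply/eqP; rewrite eq_complex /=.
by rewrite !mul0r !mulN1r opprK !add0r !eqxx.
Qed.

(** [J] acts on (1,0)-forms by i and on (0,1)-forms by -i, hence on their
    products by the product of the two scalars. *)
Lemma wedge_span_J (A B : set (1.-tuple W -> Rcomplex R)) (z w : Rcomplex R) s :
  (forall a, A a -> forall v, a [tuple J v] = z * a [tuple v]) ->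
  (forall a, B a -> forall v, a [tuple J v] = w * a [tuple v]) ->
  wedge_span A B s ->
  forall x y, s [tuple J x; J y] = (z * w) * s [tuple x; y].
Proof.
move=> Az Bw [n [a [b [aA bB ->]]]] x y.
rewrite !sum_formE mulr_sumr; apply: eq_bigr => i _.
rewrite !wedge_one_forms !(Az _ (aA i)) !(Bw _ (bB i)); ring.
Qed.

Section Basis.
Variables (g : W -> W -> R) (m : nat) (f : nat -> W).
Hypothesis F : orthonormal_frame g m f.

Variable t : 2.-tuple W -> R^o.
Hypothesis ta : alternating_multilinear t.

Let th i x := g (f i) x.

Let thl i c x y : th i (c *: x + y) = c * th i x + th i y.
Proof. exact: (inner_linr F). Qed.

Let tl i c x y :
  t [tuple f i; c *: x + y] = c * t [tuple f i; x] + t [tuple f i; y].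
Proof. exact: form2_linr. Qed.

Let contr x y : \sum_(i < m) th i x * t [tuple f i; y] = t [tuple x; y].
Proof. by rewrite [in RHS](frame_expand F x) form2_suml. Qed.

(** Write t as half the sum of f_i^* /\ t(f_i, .) and replace the first factors
    by their (1,0)-parts and the second ones by their (0,1)-parts; antisymmetry
    makes this half of the (1,1)-part of t, and the normalization below restores
    the factor. *)
Lemma real_Lambda11P : real_Lambda11 J t <-> J_invariant J t.
Proof.
split=> [[_ ts] x y|inv].
  have := wedge_span_J (z := 0 +i* 1) (w := 0 -i* 1)
    (fun a => @proj2 _ _) (fun a => @proj2 _ _) ts x y.
  rewrite /complexify => /(congr1 (@complex.Re R)) /=.
  rewrite !(mul0r, mulr0, mul1r, mulr1, mulrN, sub0r, opprK).
  by rewrite !(addr0, subr0, oppr0).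
split=> //; exists m, (fun i : 'I_m => form10 (fun x => th i x)).
exists (fun i : 'I_m => form01 (fun x => t [tuple f i; x] / 4)).
split=> [i|i|].
- by apply: form10P.
- by apply: form01P => c x y; rewrite tl; field.
have t0 z : tnth [tuple z] 0 = z :> W by [].
apply: funext => v; rewrite (tuple2E v) sum_formE.
set x := tnth v 0; set y := tnth v 1.
under eq_bigr do rewrite wedge_one_forms /form10 /form01 !t0.
apply/eqP; rewrite eq_complex /complexify; apply/andP; split; apply/eqP;
  rewrite raddf_sum /=.
  transitivity ((t [tuple x; y] + t [tuple J x; J y]
    - t [tuple y; x] - t [tuple J y; J x]) / 4).
    by rewrite !inv (form2C ta y x); field.
  rewrite -!contr -!big_split -!sumrB mulr_suml; apply: eq_bigr => i _ /=.
  by field.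
transitivity ((t [tuple x; J y] - t [tuple J x; y]
  - t [tuple y; J x] + t [tuple J y; x]) / 4).
  by rewrite (form2C ta y (J x)) (form2C ta (J y)); field.
rewrite -!contr -!sumrB -!big_split mulr_suml; apply: eq_bigr => i _ /=.
by field.
Qed.

(** The same expansion, with both factors of type (1,0), or both of type
    (0,1). *)
Lemma real_Lambda20_02P : real_Lambda20_02 J t <-> J_anti_invariant J t.
Proof.
split=> [[_ [s [u [ss uu su]]]] x y|inv].
  have := wedge_span_J (z := 0 +i* 1) (w := 0 +i* 1)
    (fun a => @proj2 _ _) (fun a => @proj2 _ _) ss x y.
  have := wedge_span_J (z := 0 -i* 1) (w := 0 -i* 1)
    (fun a => @proj2 _ _) (fun a => @proj2 _ _) uu x y.
  have E v : (t v)%:C = s v + u v :> Rcomplex R.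
    by move/(congr1 (fun h => h v)): su.
  move=> uE sE; have := E [tuple J x; J y]; rewrite uE sE.
  have Ez : (0 +i* 1) * (0 +i* 1) = -1 :> Rcomplex R.
    apply/eqP; rewrite eq_complex /= !(mul0r, mulr0, mul1r, addr0, sub0r).
    by rewrite oppr0 !eqxx.
  have Ew : (0 -i* 1) * (0 -i* 1) = -1 :> Rcomplex R.
    apply/eqP; rewrite eq_complex /= !(mul0r, mulr0, mulN1r, addr0, sub0r).
    by rewrite opprK oppr0 !eqxx.
  rewrite Ez Ew !mulN1r -opprD -E.
  by move/(congr1 (@complex.Re R)).
split=> //.
exists (\sum_(i < m) wedge (form10 (fun x => th i x / 2))
          (form10 (fun x => t [tuple f i; x] / 4))).
exists (\sum_(i < m) wedge (form01 (fun x => th i x / 2))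
          (form01 (fun x => t [tuple f i; x] / 4))).
split.
- exists m; do 2 eexists; split; last by [].
    by move=> i; apply: form10P => c x y; rewrite thl; field.
  by move=> i; apply: form10P => c x y; rewrite tl; field.
- exists m; do 2 eexists; split; last by [].
    by move=> i; apply: form01P => c x y; rewrite thl; field.
  by move=> i; apply: form01P => c x y; rewrite tl; field.
have t0 z : tnth [tuple z] 0 = z :> W by [].
apply: funext => v; rewrite (tuple2E v) fctE !sum_formE -big_split.
set x := tnth v 0; set y := tnth v 1.
under eq_bigr do rewrite !wedge_one_forms /form10 /form01 !t0.
apply/eqP; rewrite eq_complex /complexify; apply/andP; split; apply/eqP;
  rewrite raddf_sum /=.
  transitivity ((t [tuple x; y] - t [tuple J x; J y]
    - t [tuple y; x] + t [tuple J y; J x]) / 2 / 2).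
    by rewrite !inv (form2C ta y x); field.
  rewrite -!contr -!sumrB -!big_split mulr_suml mulr_suml.
  by apply: eq_bigr => i _ /=; field.
by rewrite big1 // => i _; field.
Qed.

End Basis.
End Types.

(** * Complex Gram-Schmidt *)

Section Hermitian.
Variables (R : realType) (W : vectType R) (g : W -> W -> R) (J : 'End(W)).
Hypothesis gi : is_inner_product g.
Hypothesis JJ : forall v, J (J v) = - v.
Hypothesis gJ : forall x y, g (J x) (J y) = g x y.

Let gl := let: And3 h _ _ := gi in h.
Let gC := let: And3 _ h _ := gi in h.
Let gpos := let: And3 _ _ h := gi in h.
Let gr x c y z : g x (c *: y + z) = c * g x y + g x z.
Proof. by rewrite gC gl !(gC x). Qed.

Lemma inner0r x : g x 0 = 0.
Proof.
have := gr x (-1) 0 0.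
by rewrite scaler0 addr0 mulN1r addNr.
Qed.

Lemma innerZr x c y : g x (c *: y) = c * g x y.
Proof. by rewrite -[c *: y]addr0 gr inner0r addr0. Qed.

Lemma innerDr x y z : g x (y + z) = g x y + g x z.
Proof. by rewrite -[y in LHS]scale1r gr mul1r. Qed.

Lemma innerNr x y : g x (- y) = - g x y.
Proof. by rewrite -scaleN1r innerZr mulN1r. Qed.

Lemma inner_sumr I (r : seq I) (c : I -> R) (y : I -> W) x :
  g x (\sum_(j <- r) c j *: y j) = \sum_(j <- r) c j * g x (y j).
Proof.
by elim: r => [|j r IH]; rewrite ?big_nil ?inner0r // !big_cons gr IH.
Qed.

Lemma inner_J x y : g (J x) y = - g x (J y).
Proof. by rewrite -(gJ x) JJ innerNr opprK. Qed.

Lemma inner_xJx x : g x (J x) = 0.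
Proof.
have /eqP := inner_J x x; rewrite gC -addr_eq0 -mulr2n mulrn_eq0 /=.
by move/eqP.
Qed.

Definition perp (s : seq W) (y : W) := forall x, x \in s -> g x y = 0.

Definition orthonormal (s : seq W) := forall i j,
  (i < size s)%N -> (j < size s)%N -> g (nth 0 s i) (nth 0 s j) = (i == j)%:R.

(** Stability of the span under [J], expressed on the orthogonal complement. *)
Definition J_stable (s : seq W) := forall y, perp s y -> perp s (J y).

Lemma perp_rcons s e y : perp (rcons s e) y <-> perp s y /\ g e y = 0.
Proof.
split=> [p|[p ey] x].
  by split=> [x xs|]; apply: p; rewrite mem_rcons inE ?eqxx // xs orbT.
by rewrite mem_rcons inE => /orP [/eqP ->|/p].
Qed.

Lemma perpD s c x y : perp s x -> perp s y -> perp s (c *: x + y).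
Proof. by move=> px py z zs; rewrite gr px // py // mulr0 addr0. Qed.

Lemma orthonormal_rcons s e : orthonormal s -> perp s e -> g e e = 1 ->
  orthonormal (rcons s e).
Proof.
move=> os pe ee i j; rewrite size_rcons !ltnS => i_s js; rewrite !nth_rcons.
have [il|il] := ltnP i (size s); have [jl|jl] := ltnP j (size s).
- exact: os.
- have -> : (j == size s) by rewrite eqn_leq js.
  by rewrite pe ?mem_nth // ltn_eqF // (leq_trans il).
- have -> : (i == size s) by rewrite eqn_leq i_s.
  by rewrite gC pe ?mem_nth // gtn_eqF // (leq_trans jl).
- have /eqP -> : (i == size s) by rewrite eqn_leq i_s.
  have /eqP -> : (j == size s) by rewrite eqn_leq js.
  by rewrite !eqxx.
Qed.

(** A unit vector orthogonal to a [J]-stable orthonormal system can be adjoined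
    together with its image under [J]. *)
Lemma unitary_extend s e : orthonormal s -> J_stable s -> perp s e ->
  g e e = 1 ->
  orthonormal (rcons (rcons s e) (J e)) /\ J_stable (rcons (rcons s e) (J e)).
Proof.
move=> os js pe ee; split.
  apply: orthonormal_rcons; [exact: orthonormal_rcons| |by rewrite gJ].
  by apply/perp_rcons; split; [exact: js|exact: inner_xJx].
move=> y /perp_rcons [/perp_rcons [py ey] Jey].
apply/perp_rcons; split; last by rewrite gJ.
apply/perp_rcons; split; first exact: js.
by apply/eqP; rewrite -oppr_eq0 -inner_J Jey.
Qed.

(** The last conclusion says that [w] is in the span of [s] and [e]. *)
Lemma orthonormal_complement s w : orthonormal s -> (size s < \dim {:W})%N ->
  exists e, [/\ perp s e, g e e = 1
    & forall y, perp (rcons s e) y -> g w y = 0].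
Proof.
move=> os sd.
pose pr w := \sum_(i < size s) g (nth 0 s i) w *: nth 0 s i.
have ppr x : perp s (x - pr x).
  move=> z /(nthP 0) [i i_s <-]; rewrite innerDr innerNr inner_sumr.
  rewrite (bigD1 (Ordinal i_s)) //= os // eqxx mulr1 big1 ?addr0 ?subrr //.
  move=> j /negPf ji; rewrite os // eq_sym.
  by move: ji; rewrite -val_eqE => ->; rewrite mulr0.
have prs x y : perp s y -> g (pr x) y = 0.
  move=> py; rewrite gC inner_sumr big1 // => i _.
  by rewrite (gC y) py ?mulr0 // mem_nth.
(* If w already lies in the span of s, any vector outside it will do. *)
have [w' w'n w'w] : exists2 w', w' - pr w' != 0 &
    forall y, perp s y -> g (w' - pr w') y = 0 -> g w y = 0.
  have [w0|wn] := eqVneq (w - pr w) 0; last first.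
    exists w => // y py; rewrite gC innerDr innerNr (gC _ (pr w)) prs //.
    by rewrite subr0 gC.
  have [x xs] : exists x, x \notin <<s>>%VS.
    apply: contrapT => /forallNP H; move: sd; rewrite ltnNge => /negP; apply.
    apply: leq_trans (dim_span s); apply: dimvS; apply/subvP => x _.
    by have := H x; case: (x \in _).
  exists x.
    apply: contraNneq xs => /eqP; rewrite subr_eq0 => /eqP ->.
    by apply: memv_suml => i _; apply/memvZ/memv_span/mem_nth.
  by move=> y py _; move/eqP: w0; rewrite subr_eq0 => /eqP ->; apply: prs.
have gp := gpos w'n; set p := w' - pr w' in w'n w'w gp *.
have sp : Num.sqrt (g p p) != 0 by rewrite gt_eqF // sqrtr_gt0.
exists ((Num.sqrt (g p p))^-1 *: p); split.
- by move=> x xs; rewrite innerZr (ppr w' x xs) mulr0.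
- rewrite innerZr gC innerZr mulrA -invfM -expr2 sqr_sqrtr ?ltW //.
  by rewrite mulVf // gt_eqF.
move=> y /perp_rcons [py]; rewrite gC innerZr => /eqP.
rewrite mulf_eq0 invr_eq0 (negPf sp) /= => /eqP yp.
by apply: w'w => //; rewrite gC.
Qed.

Lemma orthonormal_frame_seq s : orthonormal s -> size s = \dim {:W} ->
  orthonormal_frame g (\dim {:W}) (nth 0 s).
Proof.
move=> os ss; split=> // [i j i_s js|x]; first by apply: os; rewrite ss.
have st : size s == \dim {:W} by rewrite ss.
transitivity (\sum_i g (tnth (Tuple st) i) x *: tnth (Tuple st) i); last first.
  by apply: eq_bigr => i _; rewrite !(tnth_nth 0).
apply: (orthonormal_basis_expand gi); split; last first.
  by move=> i j; rewrite !(tnth_nth 0) /= os ?ss.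
rewrite basisEfree subvf size_tuple leqnn !andbT.
apply/freeP => k k0 i; have := congr1 (g (nth 0 s i)) k0.
rewrite inner0r inner_sumr (bigD1 i) //= os ?ss // eqxx mulr1 big1 ?addr0 //.
move=> j /negPf ji; rewrite os ?ss // eq_sym.
by move: ji; rewrite -val_eqE => ->; rewrite mulr0.
Qed.

End Hermitian.

(** * Integer tables of the standard model *)

Section Tables.

Fixpoint words (m k : nat) : seq (seq nat) :=
  if k is k'.+1 then [seq x :: K | x <- iota 0%N m, K <- words m k']
  else [:: [::]].

Lemma mem_words m k K : size K = k -> all (gtn m) K -> K \in words m k.
Proof.
elim: k K => [|k IH] [|x K] //= [sK] /andP [xm Km].
by apply/allpairsP; exists (x, K); rewrite mem_iota xm IH.
Qed.

Lemma all_words m k (P : pred (seq nat)) : all P (words m k) ->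
  forall K, size K = k -> all (gtn m) K -> P K.
Proof. by move=> /allP PK K sK Km; apply: PK; apply: mem_words. Qed.

(** The letters 2k and 2k+1 stand for the coordinates x_k and y_k of
    z_k = x_k + i y_k; the standard Kaehler form is the sum of the
    dx_k /\ dy_k. *)
Definition kaehler : word_combination :=
  [:: (1, [:: 0; 1]%N); (1, [:: 2; 3]%N); (1, [:: 4; 5]%N); (1, [:: 6; 7]%N)].

(** The real part of dz_0 /\ dz_1 /\ dz_2 /\ dz_3. *)
Definition re_dz : word_combination :=
  [:: (1, [:: 0; 2; 4; 6]%N); (1, [:: 1; 3; 5; 7]%N);
      (-1, [:: 1; 3; 4; 6]%N); (-1, [:: 1; 2; 5; 6]%N);
      (-1, [:: 1; 2; 4; 7]%N); (-1, [:: 0; 3; 5; 6]%N);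
      (-1, [:: 0; 3; 4; 7]%N); (-1, [:: 0; 2; 5; 7]%N)].

(** The imaginary part of dz_0 /\ dz_1 /\ dz_2 /\ dz_3. *)
Definition im_dz : word_combination :=
  [:: (1, [:: 1; 2; 4; 6]%N); (1, [:: 0; 3; 4; 6]%N);
      (1, [:: 0; 2; 5; 6]%N); (1, [:: 0; 2; 4; 7]%N);
      (-1, [:: 0; 3; 5; 7]%N); (-1, [:: 1; 2; 5; 7]%N);
      (-1, [:: 1; 3; 4; 7]%N); (-1, [:: 1; 3; 5; 6]%N)].

Definition kaehler2 := combination_mul kaehler kaehler.
Definition kaehler3 := combination_mul kaehler2 kaehler.

(** Twice the Cayley form, so as to have integer coefficients. *)
Definition cayley2 : word_combination := kaehler2 ++ re_dz ++ re_dz.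

(** The contractions of the Cayley form with the first vector of a frame and
    the second, respectively third, one. *)
Definition cayley01 : word_combination :=
  [:: (1, [:: 2; 3]%N); (1, [:: 4; 5]%N); (1, [:: 6; 7]%N)].
Definition cayley02 : word_combination :=
  [:: (-1, [:: 1; 3]%N); (1, [:: 4; 6]%N); (-1, [:: 5; 7]%N)].

Definition vol8 := iota 0%N 8.

Definition top_eval (l : word_combination) := combination_eval l vol8.

Definition kaehler_coef (i j : nat) := combination_eval kaehler [:: i; j].

(** Real and imaginary parts of the powers of i. *)
Definition ipow_re (n : nat) : int := nth 0 [:: 1; 0; -1; 0] (n %% 4).
Definition ipow_im (n : nat) : int := nth 0 [:: 0; 1; 0; -1] (n %% 4).

Lemma table_kaehler : all (fun K => if K is [:: p; q] then
    kaehler_coef p q == (if odd q then 1 else -1) *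
      (if p == (if odd q then q.-1 else q.+1) then 1 else 0)
  else true) (words 8 2).
Proof. by vm_compute. Qed.

Lemma table_kaehler_opp : all (fun K => if K is [:: p; q] then
    kaehler_coef q p == - kaehler_coef p q
  else true) (words 8 2).
Proof. by vm_compute. Qed.

(** In dz_0 /\ ... /\ dz_3 every vector y_k counts as i times x_k. *)
Lemma table_dz : all (fun K =>
    (combination_eval re_dz K ==
       ipow_re (count odd K) * word_delta (iota 0%N 4) (map half K)) &&
    (combination_eval im_dz K ==
       ipow_im (count odd K) * word_delta (iota 0%N 4) (map half K)))
  (words 8 4).
Proof. by vm_compute. Qed.

Definition pairing_eval (l l' : word_combination) : int :=
  foldr +%R 0 [seq x.1 * combination_eval l' x.2 | x <- l].

Lemma pairing_evalE (R : pzRingType) l l' : (pairing_eval l l')%:~R =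
  \sum_(x <- l) x.1%:~R * (combination_eval l' x.2)%:~R :> R.
Proof.
rewrite /pairing_eval foldrE big_map rmorph_sum.
by apply: eq_bigr => x _; rewrite rmorphM.
Qed.

Lemma table_pairing :
  [/\ pairing_eval re_dz re_dz = 8, pairing_eval re_dz im_dz = 0,
      pairing_eval im_dz re_dz = 0 & pairing_eval im_dz im_dz = 8].
Proof. by vm_compute. Qed.

Lemma table_volume : top_eval (combination_mul kaehler3 kaehler) = 24.
Proof. by vm_compute. Qed.

Lemma table_cayley_square : top_eval (combination_mul cayley2 cayley2) = 56.
Proof. by vm_compute. Qed.

Lemma table_cayley01 : all (fun K =>
    combination_eval cayley2 (0%N :: 1%N :: K) ==
    2 * combination_eval cayley01 K) (words 8 2).
Proof. by vm_compute. Qed.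

Lemma table_cayley02 : all (fun K =>
    combination_eval cayley2 (0%N :: 2%N :: K) ==
    2 * combination_eval cayley02 K) (words 8 2).
Proof. by vm_compute. Qed.

Definition positivity_eval l l' :=
  top_eval (combination_mul (combination_mul l l') cayley2).

Lemma table_positivity :
  [/\ positivity_eval cayley01 cayley01 = 12,
      positivity_eval cayley01 cayley02 = 0,
      positivity_eval cayley02 cayley01 = 0
    & positivity_eval cayley02 cayley02 = 12].
Proof. by vm_compute. Qed.

Lemma table_trace : all (fun K =>
    top_eval (combination_mul [:: (1, K)] kaehler3) ==
    6 * combination_eval kaehler K) (words 8 2).
Proof. by vm_compute. Qed.

(** The value on [word K] of the Hodge dual of a combination. *)
Definition star_eval l K : int :=
  foldr +%R 0 [seq x.1 * word_delta vol8 (x.2 ++ K) | x <- l].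

Lemma star_evalE (R : pzRingType) l K : (star_eval l K)%:~R =
  \sum_(x <- l) x.1%:~R * (word_delta vol8 (x.2 ++ K))%:~R :> R.
Proof.
rewrite /star_eval foldrE big_map rmorph_sum.
by apply: eq_bigr => x _; rewrite rmorphM.
Qed.

(** The real part of dz_0 /\ ... /\ dz_3 is self-dual; exchanging the two halves
    of a word of length 4 is an even permutation. *)
Lemma table_star_dz : all (fun K =>
    star_eval re_dz K == combination_eval re_dz (drop 2 K ++ take 2 K))
  (words 8 4).
Proof. by vm_compute. Qed.

(** The square of the Kaehler form is self-dual. *)
Lemma table_star_kaehler : all (fun K => if K is [:: i; j; p; q] then
    star_eval kaehler2 K ==
    2 * (kaehler_coef i j * kaehler_coef p q -
         kaehler_coef p i * kaehler_coef q j +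
         kaehler_coef p j * kaehler_coef q i)
  else true) (words 8 4).
Proof. by vm_compute. Qed.

End Tables.

(** * Special unitary frames *)

Section ComplexMultilinear.
Variables (R : realType) (W : vectType R) (J : 'End(W)).

Lemma cscale_real a v : cscale J a%:C%C v = a *: v.
Proof. by rewrite /cscale /= scale0r addr0. Qed.

Lemma cscale_i v : cscale J (0 +i* 1)%C v = J v.
Proof. by rewrite /cscale /= scale0r add0r scale1r. Qed.

Section Form.
Variables (k : nat) (Theta : k.-tuple W -> Rcomplex R).
Hypothesis Tm : complex_multilinear J Theta.

Lemma complex_multilinear_real : multilinear Theta.
Proof.
move=> v i a x y; rewrite -(cscale_real a x) Tm; congr (_ + _).
by rewrite -[RHS]mulr_algl; congr (_ * _); rewrite -[RHS]/(_ +i* _)%C; simpc.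
Qed.

Lemma complex_multilinearZ v i z x :
  Theta (setslot v i (cscale J z x)) = (z : Rcomplex R) * Theta (setslot v i x).
Proof.
have T0 : Theta (setslot v i 0) = 0.
  have := complex_multilinear_real v i (-1) 0 0.
  by rewrite scaler0 addr0 scaleN1r addNr.
by rewrite -[cscale J z x]addr0 Tm T0 addr0.
Qed.

(** The scalars are pulled out one slot at a time. *)
Lemma complex_multilinear_prod (z : 'I_k -> Rcomplex R) (w : 'I_k -> W) :
  Theta [tuple cscale J (z j) (w j) | j < k] =
  (\prod_j z j) * Theta [tuple w j | j < k].
Proof.
suff: forall n, (n <= k)%N ->
    Theta [tuple if (j < n)%N then cscale J (z j) (w j) else w j | j < k] =
    (\prod_(j < k | (j < n)%N) z j) * Theta [tuple w j | j < k].
  move/(_ k (leqnn k)) => H; rewrite -[LHS](_ : Theta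
     [tuple if (j < k)%N then cscale J (z j) (w j) else w j | j < k] = _).
    by rewrite H; congr (_ * _); apply: eq_bigl => j; rewrite ltn_ord.
  by congr Theta; apply: eq_mktuple => j; rewrite ltn_ord.
elim=> [|n IH] nk; first by rewrite big_pred0 // mul1r; congr Theta;
  apply: eq_mktuple.
pose i := Ordinal nk.
pose v := [tuple if (j < n)%N then cscale J (z j) (w j) else w j | j < k].
have -> : [tuple if (j < n.+1)%N then cscale J (z j) (w j) else w j | j < k] =
    setslot v i (cscale J (z i) (w i)).
  apply: eq_from_tnth => j; rewrite tnth_setslot !tnth_mktuple ltnS.
  case: (eqVneq j i) => [->|ji]; first by rewrite /= leqnn.
  by rewrite leq_eqVlt -[n]/(val i) val_eqE (negPf ji).
rewrite complex_multilinearZ.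
have -> : setslot v i (w i) = v.
  apply: eq_from_tnth => j; rewrite tnth_setslot !tnth_mktuple.
  by case: (eqVneq j i) => [->|//]; rewrite /= ltnn.
rewrite IH ?(ltnW nk) // mulrA; congr (_ * _).
rewrite [RHS](bigD1 i) /= ?ltnSn //; congr (_ * _); apply: eq_bigl => j.
rewrite ltnS [in RHS]leq_eqVlt -val_eqE /=.
by case: (ltngtP j n).
Qed.

End Form.
End ComplexMultilinear.

Section SU4.
Variables (R : realType) (W : vectType R) (Omega : 2.-tuple W -> R^o).
Variables (J : 'End(W)) (Theta : 4.-tuple W -> Rcomplex R).
Hypothesis dimW : \dim {:W} = 8%N.
Hypothesis SU4 : @is_SU_structure R W 4 Omega J Theta.

Local Notation g := (su_metric Omega J).

Let Oa : alternating_multilinear Omega := su_form SU4.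
Let JJ : forall v, J (J v) = - v := su_complex_structure SU4.
Let gi : is_inner_product g := su_compatible SU4.
Let gC : forall x y, g x y = g y x := let: And3 _ h _ := gi in h.

Lemma su_formE x y : Omega [tuple x; y] = - g x (J y).
Proof. by rewrite /su_metric JJ form2Nr // opprK. Qed.

Lemma su_formJ x y : Omega [tuple J x; J y] = Omega [tuple x; y].
Proof.
rewrite -[LHS]/(g (J x) y) gC -[LHS]/(Omega [tuple y; J (J x)]) JJ form2Nr //.
by rewrite -form2C.
Qed.

Lemma su_metricJ x y : g (J x) (J y) = g x y.
Proof. by rewrite /su_metric su_formJ. Qed.

Let Ta : alternating_multilinear Theta.
Proof.
by split; [exact: complex_multilinear_real (su_multilinear SU4)
          | exact: su_alternating SU4].
Qed.

Definition im_form (v : 4.-tuple W) : R^o := complex.Im (Theta v).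

Lemma altml_re : alternating_multilinear (re_form Theta).
Proof.
case: Ta => Tm Tal; split=> [v i a x y|v i j ij vij].
  by rewrite /re_form Tm; exact: Re_is_scalar.
by rewrite /re_form (Tal v i j).
Qed.

Lemma altml_im : alternating_multilinear im_form.
Proof.
case: Ta => Tm Tal; split=> [v i a x y|v i j ij vij].
  by rewrite /im_form Tm; exact: Im_is_scalar.
by rewrite /im_form (Tal v i j).
Qed.

(** Each vector with an even index is followed by its image under [J]. *)
Record unitary_frame (f : nat -> W) : Prop := {
  unitary_orthonormal : orthonormal_frame g 8 f;
  unitary_J : forall k, (k < 4)%N -> f k.*2.+1 = J (f k.*2) }.

Section Frame.
Variable f : nat -> W.
Hypothesis U : unitary_frame f.
Let F := unitary_orthonormal U.

Lemma J_frame q : (q < 8)%N -> J (f q) = if odd q then - f q.-1 else f q.+1.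
Proof.
move=> q8; have q4 : (q./2 < 4)%N by rewrite ltn_half_double.
have := odd_double_half q; case: (odd q) => /= <-.
  by rewrite add1n unitary_J // JJ.
by rewrite add0n unitary_J.
Qed.

Lemma su_form_combination : Omega = combination_form g f 2 kaehler.
Proof.
apply: (form_ext F) => //; first exact: (altml_combination F).
move=> K sK Km; rewrite (combination_word F) //.
have := all_words table_kaehler sK Km.
case: K sK Km => [|p [|q []]] //= _ /and3P [p8 q8 _] /eqP.
rewrite -[combination_eval _ _]/(kaehler_coef p q) => ->.
have -> : word f 2 [:: p; q] = [tuple f p; f q].
  by rewrite [LHS]tuple2E !tnth_mktuple.
rewrite su_formE J_frame //; case: ifP => oq.
  rewrite -scaleN1r (innerZr gi) mulN1r opprK (frame_orth F) //; last first.
    by apply: leq_ltn_trans q8; exact: leq_pred.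
  by rewrite mul1r; case: eqP.
rewrite (frame_orth F) //; last first.
  rewrite ltn_neqAle q8 andbT; apply/eqP => q7.
  by move: oq; rewrite -[q]/(q.+1.-1) q7.
by case: eqP => _; rewrite ?mulr1 ?mulr0 ?mulrN1z ?mulr0z ?oppr0.
Qed.

Lemma J_expand p : (p < 8)%N ->
  J (f p) = \sum_(i < 8) (kaehler_coef p i)%:~R *: f i.
Proof.
move=> p8; rewrite [LHS](frame_expand F); apply: eq_bigr => i _.
congr (_ *: _); rewrite -[LHS]opprK -su_formE -form2C //.
rewrite su_form_combination /kaehler_coef.
rewrite -(@combination_word _ _ _ _ _ F 2) //=.
  by rewrite [word f 2 _]tuple2E !tnth_mktuple.
by rewrite p8 ltn_ord.
Qed.

Let z0 := Theta (word f 4 [:: 0; 2; 4; 6]%N).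

Lemma i_pow n : (n <= 4)%N -> (0 +i* 1)%C ^+ n =
  ((ipow_re n)%:~R +i* (ipow_im n)%:~R)%C :> Rcomplex R.
Proof.
by case: n => [|[|[|[|[|]]]]] // _; apply/eqP; rewrite eq_complex /ipow_re
  /ipow_im /=; apply/andP; split; apply/eqP; ring.
Qed.

Lemma prod_i_pow (K : seq nat) : size K = 4%N ->
  \prod_(j < 4) (if odd (nth 0%N K j) then (0 +i* 1)%C else 1) =
  ((ipow_re (count odd K))%:~R +i* (ipow_im (count odd K))%:~R)%C :> Rcomplex R.
Proof.
move=> sK; rewrite -i_pow -?sK ?count_size // -sum1_count.
rewrite (big_nth 0%N) big_mkord sK -prodrXr [RHS]big_mkcond.
by apply: eq_bigr => j _; case: odd.
Qed.

(** A complex 4-form is determined by one value on a unitary frame: the frame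
    vectors are the even ones multiplied by 1 or i, and on words in the even
    ones [Theta] is alternating. *)
Lemma Theta_word K : size K = 4%N -> all (gtn 8) K ->
  Theta (word f 4 K) =
  ((combination_eval re_dz K)%:~R +i* (combination_eval im_dz K)%:~R)%C * z0.
Proof.
move=> sK Km; have /andP [/eqP -> /eqP ->] := all_words table_dz sK Km.
pose h i := f i.*2.
have -> : word f 4 K = [tuple cscale J
   (if odd (nth 0%N K j) then (0 +i* 1)%C else 1) (h (nth 0%N K j)./2) | j < 4].
  apply: eq_mktuple => j; set q := nth _ _ _.
  have q8 : (q < 8)%N by move/all_nthP: Km; apply; rewrite sK.
  have q4 : (q./2 < 4)%N by rewrite ltn_half_double.
  rewrite -[in LHS](odd_double_half q) /h; case: (odd q).
    by rewrite cscale_i add1n unitary_J.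
  by rewrite -[1]/(1%:C)%C cscale_real scale1r.
rewrite (complex_multilinear_prod (su_multilinear SU4)) prod_i_pow //.
have -> : [tuple h (nth 0%N K j)./2 | j < 4] = word h 4 (map half K).
  by apply: eq_mktuple => j; rewrite (nth_map 0%N) // sK.
rewrite (alternating_word h Ta) ?size_map //; last first.
  rewrite all_map; apply: sub_all Km => i /= i8.
  by rewrite ltn_half_double.
have -> : word h 4 (iota 0%N 4) = word f 4 [:: 0; 2; 4; 6]%N.
  by apply: eq_mktuple => -[[|[|[|[|]]]]].
rewrite -/z0 -[_ *: z0]mulr_algl mulrA; congr (_ * _).
apply/eqP; rewrite eq_complex /= !rmorphM /=; apply/andP.
by split; apply/eqP; ring.
Qed.

Let re_a := @altml_combination _ _ _ _ _ F 4 re_dz.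
Let im_a := @altml_combination _ _ _ _ _ F 4 im_dz.

Lemma re_Theta : re_form Theta =
  complex.Re z0 *: combination_form g f 4 re_dz +
  (- complex.Im z0) *: combination_form g f 4 im_dz.
Proof.
apply: (form_ext F); [exact: altml_re|by apply: altmlD; apply: altmlZ|].
move=> K sK Km; rewrite /re_form Theta_word // !fctE !(combination_word F) //.
rewrite !regular_scaleE; case: z0 => p q /=; ring.
Qed.

Lemma im_Theta : im_form =
  complex.Im z0 *: combination_form g f 4 re_dz +
  complex.Re z0 *: combination_form g f 4 im_dz.
Proof.
apply: (form_ext F); [exact: altml_im|by apply: altmlD; apply: altmlZ|].
move=> K sK Km; rewrite /im_form Theta_word // !fctE !(combination_word F) //.
rewrite !regular_scaleE; case: z0 => p q /=; ring.
Qed.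

(** The squared norm of [Theta] is 16 times the squared modulus of its value on
    a unitary frame, so the normalization makes that value a phase. *)
Lemma Theta_phase : complex.Re z0 ^+ 2 + complex.Im z0 ^+ 2 = 1.
Proof.
have fi l x y : homogeneous 8 4 l ->
    form_inner g (combination_form g f 4 l) (x *: combination_form g f 4 re_dz +
      y *: combination_form g f 4 im_dz) =
    x * (pairing_eval l re_dz)%:~R + y * (pairing_eval l im_dz)%:~R.
  move=> lh; rewrite (form_inner_combination F) //; last first.
    by apply: altmlD; apply: altmlZ.
  rewrite !pairing_evalE !mulr_sumr -big_split /= big_seq [RHS]big_seq.
  apply: eq_bigr => z zl.
  have /andP [/eqP sz mz] := allP lh z zl.
  by rewrite !fctE !(combination_word F) // !regular_scaleE; ring.
have lin (x y : R) (a b c : 4.-tuple W -> R^o) :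
    form_inner g (x *: a + y *: b) c =
    x * form_inner g a c + y * form_inner g b c.
  have := form_inner_lin g [:: (x, a); (y, b)] fst snd c.
  by rewrite !big_cons !big_nil !addr0.
have [rr ri ir ii] := table_pairing.
have re_re : form_inner g (re_form Theta) (re_form Theta) =
    8 * (complex.Re z0 ^+ 2 + complex.Im z0 ^+ 2).
  by rewrite re_Theta lin !fi // rr ri ir ii; ring.
have im_im : form_inner g im_form im_form =
    8 * (complex.Re z0 ^+ 2 + complex.Im z0 ^+ 2).
  by rewrite im_Theta lin !fi // rr ri ir ii; ring.
have := su_norm SU4; rewrite /complex_form_norm.
have -> : (4`!%:R)^-1 * \sum_(I : {ffun 'I_4 -> 'I_(\dim {:W})})
    (ComplexField.Normc.normc (Theta (basis_tuple g I))) ^+ 2 =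
    form_inner g (re_form Theta) (re_form Theta) + form_inner g im_form im_form.
  rewrite /form_inner -mulrDr -big_split; congr (_ * _); apply: eq_bigr => I _.
  rewrite /re_form /im_form; case: (Theta _) => a b /=.
  by rewrite sqr_sqrtr ?addr_ge0 ?sqr_ge0 // !expr2.
rewrite re_re im_im => /eqP; rewrite eqr_sqrt ?exprn_ge0 //; last first.
  by rewrite addr_ge0 // mulr_ge0 // addr_ge0 // sqr_ge0.
by move/eqP; lra.
Qed.

End Frame.

(** Such a frame identifies the structure with the standard one on C^4: the form
    [Theta] becomes dz_0 /\ dz_1 /\ dz_2 /\ dz_3. *)
Record su_frame (f : nat -> W) : Prop := {
  su_unitary : unitary_frame f;
  su_Theta : Theta (word f 4 [:: 0; 2; 4; 6]%N) = 1 }.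

Lemma unitary_frame_seq s : orthonormal g s -> size s = 8%N ->
  (forall k, (k < 4)%N -> nth 0 s k.*2.+1 = J (nth 0 s k.*2)) ->
  unitary_frame (nth 0 s).
Proof.
move=> os s8 sJ; split=> //; rewrite -dimW.
by apply: orthonormal_frame_seq => //; rewrite dimW.
Qed.

Lemma conj_phase (z : Rcomplex R) : complex.Re z ^+ 2 + complex.Im z ^+ 2 = 1 ->
  (complex.Re z -i* complex.Im z)%C * z = 1 :> Rcomplex R.
Proof.
case: z => a b /= ab; apply/eqP; rewrite eq_complex /=; apply/andP.
by split; apply/eqP; rewrite -?ab; ring.
Qed.

(** Gram-Schmidt uses up three complex directions for [u], [v] and [w]; in the
    fourth one the phase of the frame vector remains free, and it is used to
    normalize [Theta]. *)
Lemma adapted_su_frame (u v w : W) : exists f, [/\ su_frame f,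
  forall i, (0 < i < 8)%N -> g (f i) u = 0,
  forall i, (2 < i < 8)%N -> g (f i) v = 0 &
  forall i, (4 < i < 8)%N -> g (f i) w = 0].
Proof.
have next s x : orthonormal g s -> J_stable g J s -> (size s < 8)%N ->
    exists e, [/\ perp g s e, g e e = 1,
      forall y, perp g (rcons s e) y -> g x y = 0,
      orthonormal g (rcons (rcons s e) (J e)) &
      J_stable g J (rcons (rcons s e) (J e))].
  move=> os js sd.
  have [|e [pe ee ex]] := orthonormal_complement gi x os; first by rewrite dimW.
  by have [o2 j2] := unitary_extend gi JJ su_metricJ os js pe ee; exists e.
have [|//|//|e0 [_ _ x0 o2 j2]] := next [::] u; first by [].
have [//|e1 [_ _ x1 o4 j4]] := next _ v o2 j2.
have [//|e2 [_ _ x2 o6 j6]] := next _ w o4 j4.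
have [//|e3 [p3 n3 _ o8 j8]] := next _ 0 o6 j6.
rewrite /= in x0 x1 x2 o6 j6 p3 o8 j8.
pose s6 := [:: e0; J e0; e1; J e1; e2; J e2].
pose fr e := nth 0 (s6 ++ [:: e; J e]).
have fJ e k : (k < 4)%N -> fr e k.*2.+1 = J (fr e k.*2).
  by case: k => [|[|[|[|]]]].
have U3 : unitary_frame (fr e3) by apply: unitary_frame_seq => //; exact: fJ.
pose z := Theta (word (fr e3) 4 [:: 0; 2; 4; 6]%N).
have zz : complex.Re z ^+ 2 + complex.Im z ^+ 2 = 1 := Theta_phase U3.
(* Theta has the value z on the frame completed by e3, so e3 is divided by z. *)
pose e := cscale J (complex.Re z -i* complex.Im z)%C e3.
have pe : perp g s6 e.
  rewrite /e /cscale; apply: (perpD gi) => // x xs.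
  by rewrite (innerZr gi) (j6 _ p3) // mulr0.
have ee : g e e = 1.
  have xJx := inner_xJx gi JJ su_metricJ e3.
  rewrite /e /cscale /= (innerDr gi) !(innerZr gi).
  rewrite (gC _ e3) (gC _ (J e3)) !(innerDr gi) !(innerZr gi) su_metricJ.
  by rewrite (gC (J e3)) n3 xJx -[RHS]zz; ring.
have [oe _] := unitary_extend gi JJ su_metricJ o6 j6 pe ee.
have Ue : unitary_frame (fr e) by apply: unitary_frame_seq => //; exact: fJ.
have orth := frame_orth (unitary_orthonormal Ue).
exists (fr e); split.
- split=> //.
  have -> : word (fr e) 4 [:: 0; 2; 4; 6]%N =
      setslot (word (fr e3) 4 [:: 0; 2; 4; 6]%N) ord_max e.
    apply: eq_from_tnth => i; rewrite tnth_setslot !tnth_mktuple.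
    by case: i => [[|[|[|[|]]]]].
  rewrite (complex_multilinearZ (su_multilinear SU4)).
  have -> : setslot (word (fr e3) 4 [:: 0; 2; 4; 6]%N) ord_max e3 =
      word (fr e3) 4 [:: 0; 2; 4; 6]%N.
    apply: eq_from_tnth => i; rewrite tnth_setslot !tnth_mktuple.
    by case: i => [[|[|[|[|]]]]].
  exact: conj_phase zz.
- move=> i /andP [i0 i8]; rewrite gC; apply: x0 => y; rewrite inE => /eqP ->.
  by rewrite (orth 0%N) // ltn_eqF.
- move=> i /andP [i2 i8]; rewrite gC; apply: x1 => y /(nthP 0) [k k3 <-].
  have -> : nth 0 [:: e0; J e0; e1] k = fr e k by case: k k3 => [|[|[|]]].
  by rewrite orth ?ltn_eqF // (leq_trans k3).
- move=> i /andP [i4 i8]; rewrite gC; apply: x2 => y /(nthP 0) [k k5 <-].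
  have -> : nth 0 [:: e0; J e0; e1; J e1; e2] k = fr e k.
    by case: k k5 => [|[|[|[|[|]]]]].
  by rewrite orth ?ltn_eqF // (leq_trans k5).
Qed.

End SU4.

(** * The Cayley form *)

Lemma det_mx22 (R : comPzRingType) (A : 'M[R]_2) :
  \det A = A 0 0 * A 1 1 - A 0 1 * A 1 0.
Proof.
pose B i j := A (inord i) (inord j).
have AB i j : A i j = B i j by rewrite /B !inord_val.
rewrite (expand_det_row _ 0) !big_ord_recl big_ord0 /cofactor !det_mx11 !mxE.
rewrite !AB /= /bump /=; ring.
Qed.

Lemma det_mx33 (R : comPzRingType) (A : 'M[R]_3) : \det A =
  A 0 0 * (A 1 1 * A 2 2 - A 1 2 * A 2 1)
  - A 0 1 * (A 1 0 * A 2 2 - A 1 2 * A 2 0)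
  + A 0 2 * (A 1 0 * A 2 1 - A 1 1 * A 2 0).
Proof.
pose B i j := A (inord i) (inord j).
have AB i j : A i j = B i j by rewrite /B !inord_val.
rewrite (expand_det_row _ 0) !big_ord_recl big_ord0 /cofactor !det_mx22 !mxE.
rewrite !AB /= /bump /=; ring.
Qed.

Section WedgeLinear.
Variables (R : realType) (W : vectType R) (p q : nat).
Implicit Types (a : p.-tuple W -> R^o) (b : q.-tuple W -> R^o).

Lemma wedgeZl c a b : wedge (c *: a) b = c *: wedge a b.
Proof.
by have := wedge_suml [:: tt] (fun=> c) (fun=> a) b; rewrite !big_seq1.
Qed.

Lemma wedgeZr c a b : wedge a (c *: b) = c *: wedge a b.
Proof.
by have := wedge_sumr [:: tt] (fun=> c) a (fun=> b); rewrite !big_seq1.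
Qed.

Lemma wedge_lin2l c d a a' b :
  wedge (c *: a + d *: a') b = c *: wedge a b + d *: wedge a' b.
Proof.
have := wedge_suml [:: (c, a); (d, a')] fst snd b.
by rewrite !big_cons !big_nil !addr0.
Qed.

Lemma wedge_lin2r c d a b b' :
  wedge a (c *: b + d *: b') = c *: wedge a b + d *: wedge a b'.
Proof.
have := wedge_sumr [:: (c, b); (d, b')] fst a snd.
by rewrite !big_cons !big_nil !addr0.
Qed.

End WedgeLinear.

Section Cayley.
Variables (R : realType) (W : vectType R) (Omega : 2.-tuple W -> R^o).
Variables (J : 'End(W)) (Theta : 4.-tuple W -> Rcomplex R).
Hypothesis dimW : \dim {:W} = 8%N.
Hypothesis SU4 : @is_SU_structure R W 4 Omega J Theta.

Local Notation g := (su_metric Omega J).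
Local Notation vol := (su4_volume Omega).
Local Notation Phi := (su4_form Omega Theta).

Let Oa : alternating_multilinear Omega := su_form SU4.
Let JJ : forall v, J (J v) = - v := su_complex_structure SU4.
Let gi : is_inner_product g := su_compatible SU4.
Let gC : forall x y, g x y = g y x := let: And3 _ h _ := gi in h.

Section Frame.
Variable f : nat -> W.
Hypothesis S : su_frame Omega J Theta f.
Let U := su_unitary S.
Let F := unitary_orthonormal U.

Local Notation comb := (combination_form g f).

Lemma re_Theta_combination : re_form Theta = comb 4 re_dz.
Proof.
rewrite (re_Theta SU4 U) (su_Theta S).
by rewrite scale1r oppr0 scale0r addr0.
Qed.

Lemma combination_cat k l l' : comb k (l ++ l') = comb k l + comb k l'.
Proof. exact: big_cat. Qed.

Let OE : Omega = comb 2 kaehler := su_form_combination SU4 U.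

Lemma wedge_kaehler : wedge Omega Omega = comb 4 kaehler2.
Proof.
transitivity (wedge (comb 2 kaehler) (comb 2 kaehler)); first by rewrite -OE.
by rewrite (wedge_combination F).
Qed.

Lemma wedge_kaehler3 : wedge (wedge Omega Omega) Omega = comb 6 kaehler3.
Proof.
transitivity (wedge (comb 4 kaehler2) (comb 2 kaehler)).
  by rewrite -OE wedge_kaehler.
by rewrite (wedge_combination F).
Qed.

Lemma cayley_combination : Phi = (2%:R^-1 : R) *: comb 4 cayley2.
Proof.
rewrite /su4_form wedge_kaehler re_Theta_combination /cayley2.
rewrite (combination_cat 4 kaehler2) (combination_cat 4 re_dz).
rewrite [RHS]scalerDr; congr (_ + _).
rewrite -mulr2n -scaler_nat scalerA.
by rewrite mulVf ?scale1r // pnatr_eq0.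
Qed.

Lemma su4_volumeE : vol = volume_form g 8 f.
Proof.
have -> : vol = 24%:R^-1 *: wedge (comb 6 kaehler3) (comb 2 kaehler).
  by rewrite -OE -wedge_kaehler3.
rewrite (wedge_combination F) // (combination_top F) // -/(top_eval _).
rewrite table_volume scalerA.
by rewrite mulVf ?scale1r // pnatr_eq0.
Qed.

Lemma cayley_square : wedge Phi Phi = (14%:R : R) *: vol.
Proof.
rewrite cayley_combination wedgeZl wedgeZr (wedge_combination F) //.
rewrite (combination_top F) // su4_volumeE !scalerA; congr (_ *: _).
by rewrite -/(top_eval _) table_cayley_square; field.
Qed.

Lemma su4_volume_neq0 : vol <> 0.
Proof.
rewrite su4_volumeE => /(congr1 (fun h => h (word f 8 (iota 0%N 8)))).
by rewrite (volume_word_iota F); apply/eqP; exact: oner_neq0.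
Qed.

Lemma cayley_square_neq0 : wedge Phi Phi <> 0.
Proof.
rewrite cayley_square => /eqP; rewrite scaler_eq0 pnatr_eq0 /= => /eqP.
exact: su4_volume_neq0.
Qed.

End Frame.

Lemma altml_cayley : alternating_multilinear Phi.
Proof.
apply: altmlD; last exact: altml_re SU4.
by apply: altmlZ; apply: (@altml_wedge _ _ 2 2).
Qed.

Lemma adapted_expansion u v w : exists f, [/\ su_frame Omega J Theta f,
  exists a, u = a *: f 0%N,
  exists b c d, v = b *: f 0%N + c *: f 1%N + d *: f 2%N
  & exists x0 x1 x2 x3 x4, w = x0 *: f 0%N + x1 *: f 1%N + x2 *: f 2%N +
       x3 *: f 3%N + x4 *: f 4%N ].
Proof.
have [f [S fu fv fw]] := adapted_su_frame dimW SU4 u v w.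
have ex x : x = g (f 0%N) x *: f 0%N + g (f 1%N) x *: f 1%N +
    g (f 2%N) x *: f 2%N + g (f 3%N) x *: f 3%N + g (f 4%N) x *: f 4%N +
    g (f 5%N) x *: f 5%N + g (f 6%N) x *: f 6%N + g (f 7%N) x *: f 7%N.
  rewrite [LHS](frame_expand (unitary_orthonormal (su_unitary S))).
  by rewrite !big_ord_recr big_ord0 /= add0r.
exists f; split=> //.
- exists (g (f 0%N) u); rewrite [LHS]ex (fu 1%N) // (fu 2%N) // (fu 3%N) //.
  rewrite (fu 4%N) // (fu 5%N) // (fu 6%N) // (fu 7%N) //.
  by rewrite !scale0r !addr0.
- exists (g (f 0%N) v), (g (f 1%N) v), (g (f 2%N) v).
  rewrite [LHS]ex (fv 3%N) // (fv 4%N) // (fv 5%N) // (fv 6%N) // (fv 7%N) //.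
  by rewrite !scale0r !addr0.
- exists (g (f 0%N) w), (g (f 1%N) w), (g (f 2%N) w), (g (f 3%N) w).
  exists (g (f 4%N) w).
  rewrite [LHS]ex (fw 5%N) // (fw 6%N) // (fw 7%N) //.
  by rewrite !scale0r !addr0.
Qed.

Lemma wedge_square_lin (b1 b2 : 2.-tuple W -> R^o) (c d : R)
    (P : 4.-tuple W -> R^o) (b := c *: b1 + d *: b2) :
  wedge (wedge b b) P =
  c *: (c *: wedge (wedge b1 b1) P + d *: wedge (wedge b1 b2) P) +
  d *: (c *: wedge (wedge b2 b1) P + d *: wedge (wedge b2 b2) P).
Proof.
have E (b' : 2.-tuple W -> R^o) :
    wedge b' b = c *: wedge b' b1 + d *: wedge b' b2.
  exact: wedge_lin2r.
have E2 : wedge b b = c *: wedge b1 b + d *: wedge b2 b by exact: wedge_lin2l.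
rewrite E2 wedge_lin2l; congr (_ *: _ + _ *: _).
  by rewrite (E b1) wedge_lin2l.
by rewrite (E b2) wedge_lin2l.
Qed.

Section Interior.
Variable f : nat -> W.
Hypothesis S : su_frame Omega J Theta f.
Let U := su_unitary S.
Let F := unitary_orthonormal U.
Local Notation comb := (combination_form g f).

Lemma cayley_word K : size K = 4%N -> all (gtn 8) K ->
  Phi (word f 4 K) = 2%:R^-1 * (combination_eval cayley2 K)%:~R.
Proof.
by move=> sK Km; rewrite (cayley_combination S) fctE (combination_word F).
Qed.

Lemma interior_cayley_basis i j l : (i < 8)%N -> (j < 8)%N ->
  homogeneous 8 2 l ->
  all (fun K => combination_eval cayley2 (i :: j :: K) ==
                2 * combination_eval l K) (words 8 2) ->
  interior (f j) (interior (f i) Phi) = comb 2 l.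
Proof.
move=> i8 j8 lh tab.
have ij : alternating_multilinear (interior (f j) (interior (f i) Phi)).
  rewrite (_ : interior _ _ = fun v => Phi [tuple of [tuple f i; f j] ++ v]).
    exact: (@altml_catr _ _ _ 2 2 Phi [tuple f i; f j] altml_cayley).
  by apply: funext => v; congr Phi; apply: val_inj.
apply: (form_ext F) => // [|K sK Km]; first exact: (altml_combination F).
rewrite (combination_word F) // /interior !word_cons cayley_word /=; last first.
- by rewrite i8 j8.
- by rewrite sK.
rewrite (eqP (all_words tab sK Km)) rmorphM /=.
by rewrite mulrA mulVf ?mul1r // pnatr_eq0.
Qed.

Lemma interior_cayley u v a b c d :
  u = a *: f 0%N -> v = b *: f 0%N + c *: f 1%N + d *: f 2%N ->
  interior v (interior u Phi) =
  (a * c) *: comb 2 cayley01 + (a * d) *: comb 2 cayley02.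
Proof.
move=> -> ->.
rewrite -(@interior_cayley_basis 0 1) ?table_cayley01 //.
rewrite -(@interior_cayley_basis 0 2) ?table_cayley02 //.
apply: funext => w; rewrite fctE /interior.
pose h : 2.-tuple W -> R^o := fun x => Phi [tuple of x ++ w].
have ha : alternating_multilinear h.
  exact: (@altml_catl _ _ _ 2 2 Phi w altml_cayley).
have hE x y : Phi [tuple of x :: [tuple of y :: w]] = h [tuple x; y].
  by congr Phi; apply: val_inj.
have hl x y z : h [tuple x *: y; z] = x * h [tuple y; z].
  by have := form2_suml ha [:: tt] (fun=> x) (fun=> y) z; rewrite !big_seq1.
have hr x y z : h [tuple z; x *: y] = x * h [tuple z; y].
  by have := form2_sumr ha [:: tt] (fun=> x) (fun=> y) z; rewrite !big_seq1.
have h0 : h [tuple f 0%N; f 0%N] = 0.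
  by case: ha => _ /(_ _ 0 1); apply.
rewrite !hE hl -addrA !(form2_linr ha) h0 hr.
rewrite -[RHS]/(a * c * Phi [tuple of f 0%N :: [tuple of f 1%N :: w]] +
                a * d * Phi [tuple of f 0%N :: [tuple of f 2%N :: w]]).
by rewrite !hE; ring.
Qed.

Lemma wedge_wedge_cayley l l' : homogeneous 8 2 l -> homogeneous 8 2 l' ->
  wedge (wedge (comb 2 l) (comb 2 l')) Phi =
  ((2%:R^-1 : R) * (positivity_eval l l')%:~R) *: vol.
Proof.
move=> lh lh'; rewrite (wedge_combination F) // (cayley_combination S) wedgeZr.
have h4 : homogeneous 8 4 (combination_mul l l').
  exact: (@homogeneous_mul 8 2 2).
have h8 : homogeneous 8 8 (combination_mul (combination_mul l l') cayley2).
  have hP : homogeneous 8 4 cayley2 by [].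
  by have := homogeneous_mul h4 hP.
rewrite (@wedge_combination _ _ _ _ _ F 4 4) // (combination_top F) //.
by rewrite scalerA (su4_volumeE S).
Qed.

End Interior.

(** In an adapted frame u = a f_0 and v = x f_0 + c f_1 + d f_2, and the
    orientations are compared by the number 6 a^2 (c^2 + d^2) / 14. *)
Lemma cayley_positive u v
    (b : 2.-tuple W -> R^o := interior v (interior u Phi)) :
  free [:: u; v] -> same_orientation (wedge Phi Phi) (wedge (wedge b b) Phi).
Proof.
have [f [S [a ua] [x [c [d vx]]] _]] := adapted_expansion u v 0.
rewrite free_cons seq1_free span_seq1 => /andP [uv v0].
have bE := interior_cayley S ua vx.
have PP := cayley_square S; split; first exact: cayley_square_neq0 S.
have a0 : a != 0.
  by apply: contraNneq uv => a0; rewrite ua a0 scale0r mem0v.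
have cd0 : 0 < c ^+ 2 + d ^+ 2.
  rewrite lt_neqAle addr_ge0 ?sqr_ge0 // andbT eq_sym paddr_eq0 ?sqr_ge0 //.
  rewrite !sqrf_eq0; apply: contra uv => /andP [/eqP c0 /eqP d0].
  move: vx v0; rewrite c0 d0 !scale0r !addr0 => ->.
  rewrite scaler_eq0 negb_or => /andP [x0 _].
  by rewrite ua -[a](divfK x0) -scalerA; apply/memvZ/memv_line.
exists (6%:R / 14%:R * (a ^+ 2 * (c ^+ 2 + d ^+ 2))).
  apply: mulr_gt0; first by rewrite divr_gt0 ?ltr0n.
  by rewrite mulr_gt0 // exprn_even_gt0 //= a0.
rewrite PP /b bE wedge_square_lin !(wedge_wedge_cayley S) //.
have [-> -> -> ->] := table_positivity.
apply: funext => w; rewrite !fctE !regular_scaleE.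
by field.
Qed.

Definition cayley_cross (f : nat -> W) (v : 3.-tuple W) : W :=
  \sum_(i < 8) Phi [tuple of f i :: v] *: f i.

Let consE (x : W) (v : 3.-tuple W) :
  Phi [tuple of x :: v] = Phi [tuple of [tuple x] ++ v].
Proof. by congr Phi; apply: val_inj. Qed.

Lemma cayley_crossP f x v : su_frame Omega J Theta f ->
  g x (cayley_cross f v) = Phi [tuple of x :: v].
Proof.
move=> S; have F := unitary_orthonormal (su_unitary S).
rewrite /cayley_cross (inner_sumr gi) consE.
have [hm _] := @altml_catl _ _ _ 1 3 Phi v altml_cayley.
have := multilinear_sum hm [tuple 0] 0 (index_enum _)
  (fun i : 'I_8 => g (f i) x) (fun i => f i).
have s1 y : setslot [tuple 0] 0 y = [tuple y] :> 1.-tuple W.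
  by apply: eq_from_tnth => i; rewrite tnth_setslot !ord1.
rewrite -(frame_expand F x) s1 => ->; apply: eq_bigr => i _.
by rewrite s1 -consE mulrC gC.
Qed.

Lemma altml_cayley_cross f : alternating_multilinear (cayley_cross f).
Proof.
rewrite (_ : cayley_cross f = \sum_(i < 8) (fun v : 3.-tuple W =>
   Phi [tuple of f i :: v] *: f i)); last first.
  by apply: funext => v; rewrite sum_formE.
apply: altml_sum => i.
have [hm ha] := @altml_catr _ _ _ 1 3 Phi [tuple f i] altml_cayley.
split=> [v j a x y|v j k jk vjk]; rewrite !consE.
  by rewrite hm scalerDl scalerA.
by rewrite (ha v j k) ?scale0r.
Qed.

(** The values of the Cayley form on (f_i, f_0, f_j, f_k) for j < 3 and k < 5,
    the vectors that enter when three vectors are expanded in a frame adapted to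
    them. *)
Definition cross_table (i j k : nat) : int :=
  match i, j, k with
  | 2%N, 1%N, 3%N | 3%N, 2%N, 1%N => 1
  | 1%N, 2%N, 3%N | 3%N, 1%N, 2%N | 5%N, 1%N, 4%N | 6%N, 2%N, 4%N => -1
  | _, _, _ => 0
  end.

Lemma table_cross : all (fun i => all (fun j => all (fun k =>
    combination_eval cayley2 [:: i; 0%N; j; k] == 2 * cross_table i j k)
  (iota 0%N 5)) (iota 0%N 3)) (iota 0%N 8).
Proof. by vm_compute. Qed.

Let sum_tuple (f : nat -> W) n (x : nat -> R) := \sum_(j < n) x j *: f j.

Lemma cayley_adapted f i a (y x : nat -> R) : su_frame Omega J Theta f ->
  (i < 8)%N ->
  Phi [tuple f i; a *: f 0%N; sum_tuple f 3 y; sum_tuple f 5 x] =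
  a * \sum_(j < 3) \sum_(k < 5) y j * x k * (cross_table i j k)%:~R.
Proof.
move=> S i8; have [cm _] := altml_cayley.
have slot (v : 4.-tuple W) (j : 'I_4) n (z : nat -> R) :
    Phi (setslot v j (sum_tuple f n z)) =
    \sum_(l < n) z l * Phi (setslot v j (f l)).
  by rewrite (multilinear_sum cm).
have slot1 (p q r s t : W) :
    [tuple p; q; r; s] = setslot [tuple p; t; r; s] 1 q.
  by apply: eq_from_tnth => -[[|[|[|[|]]]] ?] //; rewrite tnth_setslot.
have slot2 (p q r s t : W) :
    [tuple p; q; r; s] = setslot [tuple p; q; t; s] 2 r.
  by apply: eq_from_tnth => -[[|[|[|[|]]]] ?] //; rewrite tnth_setslot.
have slot3 (p q r s t : W) :
    [tuple p; q; r; s] = setslot [tuple p; q; r; t] 3 s.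
  by apply: eq_from_tnth => -[[|[|[|[|]]]] ?] //; rewrite tnth_setslot.
have -> : a *: f 0%N = sum_tuple f 1 (fun=> a) by rewrite /sum_tuple big_ord1.
rewrite (slot1 _ _ _ _ 0) slot big_ord1 -slot1; congr (_ * _).
rewrite (slot2 _ _ _ _ 0) slot; apply: eq_bigr => j _; rewrite -slot2.
rewrite (slot3 _ _ _ _ 0) slot mulr_sumr; apply: eq_bigr => k _; rewrite -slot3.
have -> : [tuple f i; f 0%N; f j; f k] = word f 4 [:: i; 0%N; j : nat; k : nat].
  by apply: eq_from_tnth => -[[|[|[|[|]]]] ?] //; rewrite tnth_mktuple.
rewrite (cayley_word S) //=; last first.
  by rewrite i8 (leq_trans (ltn_ord j)) // (leq_trans (ltn_ord k)).
have /eqP -> : combination_eval cayley2 [:: i; 0%N; j : nat; k : nat] ==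
    2 * cross_table i j k.
  have := table_cross; move=> /allP /(_ i); rewrite mem_iota => /(_ i8).
  move=> /allP /(_ j); rewrite mem_iota => /(_ (ltn_ord j)).
  by move=> /allP /(_ k); rewrite mem_iota => /(_ (ltn_ord k)).
by rewrite rmorphM /=; field.
Qed.

Lemma gram_adapted f (x y : nat -> R) : su_frame Omega J Theta f ->
  g (sum_tuple f 5 x) (sum_tuple f 5 y) =
  x 0%N * y 0%N + x 1%N * y 1%N + x 2%N * y 2%N + x 3%N * y 3%N + x 4%N * y 4%N.
Proof.
move=> S; transitivity (\sum_(j < 5) x j * y j); last first.
  by rewrite !big_ord_recr big_ord0 /= add0r.
have F := unitary_orthonormal (su_unitary S).
rewrite (inner_sumr gi); apply: eq_bigr => j _; rewrite mulrC gC; congr (_ * _).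
rewrite (inner_sumr gi) (bigD1 j) //= (frame_orth F);
  rewrite ?(leq_trans (ltn_ord j)) //.
rewrite eqxx mulr1 big1 ?addr0 // => k kj.
rewrite (frame_orth F) ?(leq_trans (ltn_ord j)) ?(leq_trans (ltn_ord k)) //.
by move: kj; rewrite -val_eqE eq_sym => /negPf ->; rewrite mulr0.
Qed.

(** In a frame adapted to the three vectors, these have only nine components,
    and both sides become explicit polynomials in them. *)
Lemma cayley_cross_norm f v : su_frame Omega J Theta f ->
  g (cayley_cross f v) (cayley_cross f v) =
  \det (\matrix_(i < 3, j < 3) g (tnth v i) (tnth v j)).
Proof.
move=> S; rewrite det_mx33 !mxE.
have [e [Se [a ua] [b [c [d vE]]] [x0 [x1 [x2 [x3 [x4 wE]]]]]]] :=
  adapted_expansion (tnth v 0) (tnth v 1) (tnth v 2).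
have Fe := unitary_orthonormal (su_unitary Se).
have vT : v = [tuple tnth v 0; tnth v 1; tnth v 2].
  apply: eq_from_tnth => -[[|[|[|]]] ?] //=; congr tnth; exact: val_inj.
pose us := nth 0 [:: a]; pose vs := nth 0 [:: b; c; d].
pose ws := nth 0 [:: x0; x1; x2; x3; x4].
have u5 : tnth v 0 = sum_tuple e 5 us.
  by rewrite ua /sum_tuple !big_ord_recr big_ord0 /= !scale0r add0r !addr0.
have v3 : tnth v 1 = sum_tuple e 3 vs.
  by rewrite vE /sum_tuple !big_ord_recr big_ord0 /= add0r.
have v5 : tnth v 1 = sum_tuple e 5 vs.
  by rewrite vE /sum_tuple !big_ord_recr big_ord0 /= !scale0r add0r !addr0.
have w5 : tnth v 2 = sum_tuple e 5 ws.
  by rewrite wE /sum_tuple !big_ord_recr big_ord0 /= add0r.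
have -> : g (cayley_cross f v) (cayley_cross f v) = \sum_(i < 8)
    (a * \sum_(j < 3) \sum_(k < 5) vs j * ws k * (cross_table i j k)%:~R) ^+ 2.
  (* The cross product is characterized by its inner products, so that its
     components can be read in the adapted frame e instead of f. *)
  rewrite {2}[cayley_cross f v](frame_expand Fe) (inner_sumr gi).
  apply: eq_bigr => i _; rewrite (gC (cayley_cross f v)) -expr2.
  rewrite cayley_crossP //; congr (_ ^+ 2).
  rewrite -(cayley_adapted a vs ws Se (ltn_ord i)); congr Phi.
  rewrite -v3 -w5 -ua [in LHS]vT; exact: val_inj.
rewrite u5 v5 w5 !gram_adapted // /us /vs /ws /= => {u5 v5 v3 w5}.
pose s i := \sum_(j < 3) \sum_(k < 5) vs j * ws k * (cross_table i j k)%:~R.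
rewrite -[LHS]/(\sum_(i < 8) (a * s i) ^+ 2) !big_ord_recr big_ord0 /=.
have sE i : s i = \sum_(j < 3) (vs j * ws 0%N * (cross_table i j 0)%:~R +
    vs j * ws 1%N * (cross_table i j 1)%:~R +
    vs j * ws 2%N * (cross_table i j 2)%:~R +
    vs j * ws 3%N * (cross_table i j 3)%:~R +
    vs j * ws 4%N * (cross_table i j 4)%:~R).
  by apply: eq_bigr => j _; rewrite !big_ord_recr big_ord0 /= add0r.
have s0 : s 0%N = 0.
  by rewrite sE !big_ord_recr big_ord0 /= /vs /ws /=; ring.
have s1 : s 1%N = - (d * x3).
  by rewrite sE !big_ord_recr big_ord0 /= /vs /ws /=; ring.
have s2 : s 2%N = c * x3.
  by rewrite sE !big_ord_recr big_ord0 /= /vs /ws /=; ring.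
have s3 : s 3%N = d * x1 - c * x2.
  by rewrite sE !big_ord_recr big_ord0 /= /vs /ws /=; ring.
have s4 : s 4%N = 0.
  by rewrite sE !big_ord_recr big_ord0 /= /vs /ws /=; ring.
have s5 : s 5%N = - (c * x4).
  by rewrite sE !big_ord_recr big_ord0 /= /vs /ws /=; ring.
have s6 : s 6%N = - (d * x4).
  by rewrite sE !big_ord_recr big_ord0 /= /vs /ws /=; ring.
have s7 : s 7%N = 0.
  by rewrite sE !big_ord_recr big_ord0 /= /vs /ws /=; ring.
rewrite s0 s1 s2 s3 s4 s5 s6 s7; ring.
Qed.

Lemma cayley_compatible : compatible_inner_product Phi g.
Proof.
split=> //; have [f [S _ _ _]] := adapted_su_frame dimW SU4 0 0 0.
exists (cayley_cross f) => [x v|]; first exact: cayley_crossP.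
split=> [|v i|v]; first exact: altml_cayley_cross.
  rewrite gC cayley_crossP //.
  case: altml_cayley => _ /(_ _ 0 (lift 0 i)); apply.
    by rewrite neq_lift.
  by rewrite tnth0 tnthS.
by rewrite /wedge_norm cayley_cross_norm.
Qed.

Lemma cayley_orientation : compatible_orientation Phi vol.
Proof.
have [f [S _ _ _]] := adapted_su_frame dimW SU4 0 0 0.
split; first exact: cayley_square_neq0 S.
exists (14%:R^-1); first by rewrite invr_gt0 ltr0n.
by rewrite (cayley_square S) scalerA mulVf ?scale1r // pnatr_eq0.
Qed.

End Cayley.

(** * The two eigenspaces *)

Section Hodge.
Variables (R : realType) (W : vectType R).

Lemma hodge_lin (g : W -> W -> R) k n (vol : (k + n).-tuple W -> R^o) I
  (r : seq I) (x : I -> R) (a : I -> k.-tuple W -> R^o) :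
  hodge g vol (\sum_(i <- r) x i *: a i) =
  \sum_(i <- r) x i *: hodge g vol (a i).
Proof.
by apply: funext => v; rewrite sum_formE /hodge form_inner_lin.
Qed.

Lemma altml_hodge (g : W -> W -> R) k n (vol : (k + n).-tuple W -> R^o) a :
  alternating_multilinear vol ->
  alternating_multilinear (hodge g vol a : n.-tuple W -> R^o).
Proof.
move=> va; rewrite (_ : hodge g vol a = (k`!%:R)^-1 *:
  \sum_(I : {ffun 'I_k -> 'I_(\dim {:W})}) a (basis_tuple g I) *:
    (fun v : n.-tuple W => vol [tuple of basis_tuple g I ++ v] : R^o)).
  by apply: altmlZ; apply: altml_sum => I; apply: altmlZ; apply: altml_catr.
by apply: funext => v; rewrite fctE sum_formE.
Qed.

Lemma two_form_expand (g : W -> W -> R) m f (t : 2.-tuple W -> R^o) :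
  orthonormal_frame g m f -> alternating_multilinear t ->
  t = \sum_(ij : 'I_m * 'I_m) (t [tuple f ij.1; f ij.2] / 2) *:
    monomial_form g f 2 [:: ij.1 : nat; ij.2 : nat].
Proof.
move=> F ta; apply: funext => v; rewrite sum_formE.
set x := tnth v 0; set y := tnth v 1.
have tE a b : t [tuple a; b] =
    \sum_(i < m) \sum_(j < m) g (f i) a * g (f j) b * t [tuple f i; f j].
  rewrite [in LHS](frame_expand F a) form2_suml //; apply: eq_bigr => i _.
  rewrite [in LHS](frame_expand F b) form2_sumr // mulr_sumr.
  by apply: eq_bigr => j _; rewrite mulrA.
transitivity ((t [tuple x; y] - t [tuple y; x]) / 2).
  by rewrite (form2C ta y x) [in LHS](tuple2E v) -/x -/y; field.
rewrite !tE -(pair_big xpredT xpredT (fun i j : 'I_m =>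
  (t [tuple f i; f j] / 2) *: monomial_form g f 2 [:: i : nat; j : nat] v)) /=.
rewrite -sumrB mulr_suml; apply: eq_bigr => i _.
rewrite -sumrB mulr_suml; apply: eq_bigr => j _.
by rewrite /monomial_form det_mx22 !mxE /= -/x -/y regular_scaleE; field.
Qed.

End Hodge.

Section LambdaTwo.
Variables (R : realType) (W : vectType R) (Omega : 2.-tuple W -> R^o).
Variables (J : 'End(W)) (Theta : 4.-tuple W -> Rcomplex R).
Hypothesis dimW : \dim {:W} = 8%N.
Hypothesis SU4 : @is_SU_structure R W 4 Omega J Theta.

Local Notation g := (su_metric Omega J).
Local Notation vol := (su4_volume Omega).
Local Notation Phi := (su4_form Omega Theta).

Let Oa : alternating_multilinear Omega := su_form SU4.
Let JJ : forall v, J (J v) = - v := su_complex_structure SU4.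
Let gi : is_inner_product g := su_compatible SU4.
Let gC : forall x y, g x y = g y x := let: And3 _ h _ := gi in h.

Variable f : nat -> W.
Hypothesis S : su_frame Omega J Theta f.
Let U := su_unitary S.
Let F := unitary_orthonormal U.
Local Notation comb := (combination_form g f).

Let va : alternating_multilinear vol.
Proof. by rewrite (su4_volumeE SU4 S); exact: (altml_monomial F). Qed.

Let wordE p q : word f 2 [:: p; q] = [tuple f p; f q].
Proof. by rewrite [LHS]tuple2E !tnth_mktuple. Qed.

Section TwoForm.
Variable t : 2.-tuple W -> R^o.
Hypothesis ta : alternating_multilinear t.

Lemma wedge_two_form_expand l : homogeneous 8 4 l ->
  wedge (comb 4 l) t = \sum_(ij : 'I_8 * 'I_8) (t [tuple f ij.1; f ij.2] / 2) *:
    comb 6 (combination_mul l [:: (1, [:: ij.1 : nat; ij.2 : nat])]).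
Proof.
move=> lh; rewrite [in LHS](two_form_expand F ta) wedge_sumr.
apply: eq_bigr => -[i j] _ /=; congr (_ *: _).
have h2 : homogeneous 8 2 [:: (1, [:: i : nat; j : nat])].
  by rewrite /homogeneous /= !ltn_ord.
rewrite -(wedge_combination F lh h2); congr (wedge _ _).
by rewrite /combination_form big_seq1 scale1r.
Qed.

Lemma hodge_wedge_word l p q : homogeneous 8 4 l -> (p < 8)%N -> (q < 8)%N ->
  @hodge R W g 6 2 vol (wedge (comb 4 l) t) (word f 2 [:: p; q]) =
  2^-1 * \sum_(i < 8) \sum_(j < 8)
    t [tuple f i; f j] * (star_eval l [:: i : nat; j : nat; p; q])%:~R.
Proof.
move=> lh p8 q8; rewrite wedge_two_form_expand // (@hodge_lin _ _ g 6 2).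
rewrite sum_formE pair_big /= mulr_sumr; apply: eq_bigr => -[i j] _ /=.
have h2 : homogeneous 8 2 [:: (1, [:: i : nat; j : nat])].
  by rewrite /homogeneous /= !ltn_ord.
rewrite fctE regular_scaleE [RHS]mulrA [2^-1 * _]mulrC; congr (_ * _).
rewrite (hodge_combination F) //; last exact: homogeneous_mul lh h2.
rewrite star_evalE /combination_mul big_allpairs_dep big_seq [RHS]big_seq.
apply: eq_bigr => x xl; rewrite big_seq1 mulr1.
have /andP [/eqP sx mx] := allP lh x xl.
congr (_ * _).
rewrite (word_cat_seq f (p := 6) (q := 2)) //; last by rewrite size_cat sx.
rewrite -catA (su4_volumeE SU4 S) /volume_form (monomial_word F) //.
  by rewrite size_cat sx.
by rewrite all_cat mx /= !ltn_ord p8 q8.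
Qed.

(** The contraction of t with [Omega]; every pair of frame vectors
    (f_2k, f_2k+1) is met twice. *)
Definition kaehler_trace := 2^-1 * \sum_(i < 8) t [tuple f i; J (f i)].

Definition J_pullback : 2.-tuple W -> R^o :=
  fun v => t [tuple J (tnth v 0); J (tnth v 1)].

Lemma altml_J_pullback : alternating_multilinear J_pullback.
Proof.
split=> [v i a x y|v i j ij vij]; rewrite /J_pullback.
  rewrite !tnth_setslot; case: i => [[|[|//]] ?] /=; rewrite linearP.
    by rewrite form2_linl.
  by rewrite form2_linr.
have two (l : 'I_2) : l = 0 \/ l = 1.
  by case: l => [[|[|//]] ?]; [left|right]; apply: val_inj.
have v01 : tnth v 0 = tnth v 1.
  by case: (two i) (two j) ij vij => -> [] ->.
by case: ta => _ /(_ _ 0 1); apply=> //; rewrite v01.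
Qed.

Lemma contract_kaehler : \sum_(i < 8) \sum_(j < 8)
  t [tuple f i; f j] * (kaehler_coef i j)%:~R = 2 * kaehler_trace.
Proof.
rewrite /kaehler_trace mulrA mulfV ?pnatr_eq0 // mul1r; apply: eq_bigr => i _.
rewrite (J_expand SU4 U (ltn_ord i)) form2_sumr //.
by apply: eq_bigr => j _; rewrite mulrC.
Qed.

Lemma contract_J p q : (p < 8)%N -> (q < 8)%N -> \sum_(i < 8) \sum_(j < 8)
  t [tuple f i; f j] * (kaehler_coef p i * kaehler_coef q j)%:~R =
  t [tuple J (f p); J (f q)].
Proof.
move=> p8 q8; rewrite (J_expand SU4 U p8) form2_suml //; apply: eq_bigr => i _.
rewrite (J_expand SU4 U q8) form2_sumr // mulr_sumr; apply: eq_bigr => j _.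
by rewrite rmorphM mulrC -mulrA.
Qed.

Let intr_combine (x : R) (a b c d e h : int) :
  x * (2 * (a * b - c * d + e * h))%:~R =
  2 * (x * a%:~R * b%:~R - x * (c * d)%:~R + x * (h * e)%:~R).
Proof. by rewrite !(rmorphM, rmorphD, rmorphN) /=; ring. Qed.

(** On 2-forms the star of the product with half the square of [Omega] is the
    trace part minus the action of [J]. *)
Lemma hodge_kaehler :
  @hodge R W g 6 2 vol (wedge (2%:R^-1 *: wedge Omega Omega) t) =
  kaehler_trace *: Omega - J_pullback.
Proof.
have nJ : alternating_multilinear (- J_pullback).
  by rewrite -scaleN1r; apply: altmlZ; apply: altml_J_pullback.
apply: (form_ext F).
- exact: (@altml_hodge _ _ g 6 2).
- by apply: altmlD => //; apply: altmlZ.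
move=> [|p [|q []]] //= _ /and3P [p8 q8 _].
rewrite wedgeZl.
have := hodge_lin g (vol : (6 + 2).-tuple W -> R^o) [:: tt] (fun=> 2%:R^-1)
  (fun=> wedge (wedge Omega Omega) t).
rewrite !big_seq1 => ->; rewrite (wedge_kaehler SU4 S).
rewrite -[LHS]/(2%:R^-1 * @hodge R W g 6 2 vol (wedge (comb 4 kaehler2) t)
  (word f 2 [:: p; q])).
rewrite hodge_wedge_word //.
under eq_bigr => i _.
  under eq_bigr => j _.
    rewrite (eqP (all_words (k := 4) table_star_kaehler
      (K := [:: i : nat; j : nat; p; q]) erefl _)); last first.
      by rewrite /= !ltn_ord p8 q8.
    over.
  over.
rewrite wordE -[RHS]/(kaehler_trace * Omega [tuple f p; f q] -
  t [tuple J (f p); J (f q)]).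
have -> : Omega [tuple f p; f q] = (kaehler_coef p q)%:~R.
  rewrite (su_form_combination SU4 U) -wordE (combination_word F) //=.
  by rewrite p8 q8.
transitivity (2%:R^-1 * (2%:R^-1 * (2%:R * (
    (\sum_(i < 8) \sum_(j < 8) t [tuple f i; f j] *
       (kaehler_coef i j)%:~R) * (kaehler_coef p q)%:~R
  - \sum_(i < 8) \sum_(j < 8) t [tuple f i; f j] *
       (kaehler_coef p i * kaehler_coef q j)%:~R
  + \sum_(i < 8) \sum_(j < 8) t [tuple f i; f j] *
       (kaehler_coef q i * kaehler_coef p j)%:~R)))).
  congr (_ * (_ * _)); rewrite mulr_suml -sumrB -big_split mulr_sumr.
  apply: eq_bigr => i _; rewrite mulr_suml -sumrB -big_split mulr_sumr.
  apply: eq_bigr => j _; exact: intr_combine.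
by rewrite contract_kaehler !contract_J // (form2C ta (J (f q))); field.
Qed.

Definition re_contraction : 2.-tuple W -> R^o := fun v =>
  2^-1 * \sum_(i < 8) \sum_(j < 8)
    t [tuple f i; f j] * re_form Theta [tuple of v ++ [tuple f i; f j]].

Lemma altml_re_contraction : alternating_multilinear re_contraction.
Proof.
have ra := altml_re SU4.
rewrite (_ : re_contraction = (2^-1 : R) *: \sum_(i < 8) \sum_(j < 8)
    t [tuple f i; f j] *: (fun v : 2.-tuple W =>
       re_form Theta [tuple of v ++ [tuple f i; f j]] : R^o)).
  apply: altmlZ; apply: altml_sum => i; apply: altml_sum => j; apply: altmlZ.
  exact: (@altml_catl _ _ _ 2 2).
apply: funext => v; rewrite -[RHS]/(2^-1 * _) /re_contraction sum_formE.
by congr (_ * _); apply: eq_bigr => i _; rewrite sum_formE.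
Qed.

(** [Re Theta] is self-dual, so that wedging with it and applying the Hodge
    star amounts to contracting with it. *)
Lemma hodge_re :
  @hodge R W g 6 2 vol (wedge (re_form Theta) t) = re_contraction.
Proof.
apply: (form_ext F).
- exact: (@altml_hodge _ _ g 6 2).
- exact: altml_re_contraction.
move=> [|p [|q []]] //= _ /and3P [p8 q8 _].
transitivity (@hodge R W g 6 2 vol (wedge (comb 4 re_dz) t)
  (word f 2 [:: p; q])).
  by rewrite -(re_Theta_combination SU4 S).
rewrite hodge_wedge_word // /re_contraction; congr (_ * _).
apply: eq_bigr => i _; apply: eq_bigr => j _; congr (_ * _).
have Km : all (gtn 8) [:: i : nat; j : nat; p; q] by rewrite /= !ltn_ord p8 q8.
rewrite (eqP (all_words (k := 4) table_star_dz
  (K := [:: i : nat; j : nat; p; q]) erefl Km)).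
have -> : [tuple of word f 2 [:: p; q] ++ [tuple f i; f j]] =
    word f 4 [:: p; q; i : nat; j : nat] :> 4.-tuple W.
  rewrite -[RHS](word_cat_seq f (p := 2) (q := 2) (L := [:: p; q])
    (M := [:: i : nat; j : nat])) //.
  by case: _ / (wordE i j).
rewrite (re_Theta_combination SU4 S) (combination_word F) //=.
by rewrite p8 q8 !ltn_ord.
Qed.

End TwoForm.

Lemma setslotC k (v : k.-tuple W) i j x y : i != j ->
  setslot (setslot v i x) j y = setslot (setslot v j y) i x.
Proof.
move=> ij; apply: eq_from_tnth => l; rewrite !tnth_setslot.
by case: (eqVneq l i) => [->|//]; rewrite (negPf ij).
Qed.

Lemma re_Theta_JJ v i j x y : i != j ->
  re_form Theta (setslot (setslot v i (J x)) j (J y)) =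
  - re_form Theta (setslot (setslot v i x) j y).
Proof.
move=> ij; have TZ := complex_multilinearZ (su_multilinear SU4).
rewrite /re_form -(cscale_i J y) TZ setslotC // -(cscale_i J x) TZ mulrA.
rewrite [in LHS]setslotC 1?eq_sym //.
by case: (Theta _) => a b /=; ring.
Qed.

Lemma re_contraction_anti t : J_anti_invariant J (re_contraction t).
Proof.
move=> x y; rewrite /re_contraction -mulrN -sumrN; congr (_ * _).
apply: eq_bigr => i _; rewrite -sumrN; apply: eq_bigr => j _.
rewrite -mulrN; congr (_ * _).
have e a b : [tuple of [tuple a; b] ++ [tuple f i; f j]] =
    setslot (setslot [tuple 0; 0; f i; f j] 0 a) 1 b :> 4.-tuple W.
  by apply: eq_from_tnth => -[[|[|[|[|]]]] ?] //; rewrite !tnth_setslot.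
by rewrite !e re_Theta_JJ.
Qed.

(** The contraction of [Theta], which is complex bilinear in the contracted
    slots, with a form that [J] preserves is its own opposite. *)
Lemma re_contraction_invariant t : alternating_multilinear t ->
  J_invariant J t -> re_contraction t = 0.
Proof.
move=> ta inv; apply: funext => v; rewrite /re_contraction.
pose h : 2.-tuple W -> R^o := fun u => re_form Theta [tuple of v ++ u].
have ha : alternating_multilinear h.
  by apply: (@altml_catr _ _ _ 2 2); exact: altml_re SU4.
have hJ a b : h [tuple J a; J b] = - h [tuple a; b].
  have e x y : [tuple of v ++ [tuple x; y]] =
      setslot (setslot [tuple tnth v 0; tnth v 1; 0; 0] 2 x) 3 y :> 4.-tuple W.
    rewrite [in LHS](tuple2E v).
    by apply: eq_from_tnth => -[[|[|[|[|]]]] ?] //; rewrite !tnth_setslot.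
  by rewrite /h !e re_Theta_JJ.
have coefC i j : (i < 8)%N -> (j < 8)%N ->
    kaehler_coef j i = - kaehler_coef i j.
  move=> i8 j8; have ij8 : all (gtn 8) [:: i; j] by rewrite /= i8 j8.
  exact/eqP/(all_words (k := 2) table_kaehler_opp (K := [:: i; j]) erefl ij8).
set X := \sum_(i < 8) _.
suff XX : X = - X.
  have /eqP : X + X = 0 by rewrite {1}XX addNr.
  by rewrite -mulr2n mulrn_eq0 /= => /eqP ->; rewrite mulr0.
transitivity (\sum_(i < 8) \sum_(j < 8) \sum_(k < 8) \sum_(l < 8)
    t [tuple f k; f l] * (h [tuple f i; f j] *
      (kaehler_coef k i * kaehler_coef l j)%:~R)).
  apply: eq_bigr => i _; apply: eq_bigr => j _.
  rewrite -[in LHS]inv -contract_J // mulr_suml; apply: eq_bigr => k _.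
  rewrite mulr_suml; apply: eq_bigr => l _.
  rewrite (coefC k i) // (coefC l j) // mulrNN -mulrA; congr (_ * _).
  exact: mulrC.
under eq_bigr do rewrite exchange_big.
rewrite exchange_big /X -sumrN; apply: eq_bigr => k _.
under eq_bigr do rewrite exchange_big.
rewrite exchange_big -sumrN; apply: eq_bigr => l _.
under eq_bigr do rewrite -mulr_sumr.
by rewrite -mulr_sumr contract_J // hJ mulrN.
Qed.

Lemma wedge_cube t : alternating_multilinear t ->
  wedge t (wedge (wedge Omega Omega) Omega) =
  (6%:R * kaehler_trace t : R) *: vol.
Proof.
move=> ta; rewrite (wedge_kaehler3 SU4 S) [in LHS](two_form_expand F ta).
rewrite wedge_suml.
transitivity (\sum_(ij : 'I_8 * 'I_8)
  (6%:R / 2 * (t [tuple f ij.1; f ij.2] *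
     (kaehler_coef ij.1 ij.2)%:~R) : R) *: vol).
  apply: eq_bigr => -[i j] _ /=.
  have h2 : homogeneous 8 2 [:: (1, [:: i : nat; j : nat])].
    by rewrite /homogeneous /= !ltn_ord.
  have h6 : homogeneous 8 6 kaehler3 by [].
  have -> : monomial_form g f 2 [:: i : nat; j : nat] =
      comb 2 [:: (1, [:: i : nat; j : nat])].
    by rewrite /combination_form big_seq1 scale1r.
  have h8 : homogeneous 8 8
      (combination_mul [:: (1, [:: i : nat; j : nat])] kaehler3).
    by have := homogeneous_mul h2 h6.
  rewrite (@wedge_combination _ _ _ _ _ F 2 6) // (combination_top F) //.
  have Km : all (gtn 8) [:: i : nat; j : nat] by rewrite /= !ltn_ord.
  rewrite -/(top_eval _) (eqP (all_words (k := 2) table_trace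
    (K := [:: i : nat; j : nat]) erefl Km)) -(su4_volumeE SU4 S).
  rewrite scalerA -/(kaehler_coef i j) rmorphM; congr (_ *: _).
  by move: (kaehler_coef i j) => n; field.
rewrite -scaler_suml -mulr_sumr; congr (_ *: _).
rewrite -(pair_big xpredT xpredT (fun i j : 'I_8 =>
  t [tuple f i; f j] * (kaehler_coef i j)%:~R)) /= contract_kaehler //.
by field.
Qed.

Lemma hodge_cayley t : alternating_multilinear t ->
  @hodge R W g 6 2 vol (wedge Phi t) =
  kaehler_trace t *: Omega - J_pullback t +
  @hodge R W g 6 2 vol (wedge (re_form Theta) t).
Proof.
move=> ta; rewrite -hodge_kaehler //.
have := hodge_lin g (vol : (6 + 2).-tuple W -> R^o)
  [:: wedge (2%:R^-1 *: wedge Omega Omega) t; wedge (re_form Theta) t]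
  (fun=> 1) id.
rewrite !big_cons !big_nil !scale1r !addr0 => <-; congr (hodge _ _ _).
have := wedge_lin2l 1 1 (2%:R^-1 *: wedge Omega Omega) (re_form Theta) t.
by rewrite !scale1r.
Qed.

(* The operator whose eigenspaces for 2 and -2 appear in the decomposition. *)
Local Notation S_ := (fun t => @hodge R W g 6 2 vol (wedge (re_form Theta) t)).

Lemma hodge_re_lin c d t t' :
  S_ (c *: t + d *: t') = c *: S_ t + d *: S_ t'.
Proof.
rewrite /= wedge_lin2r.
have := hodge_lin g (vol : (6 + 2).-tuple W -> R^o)
  [:: (c, wedge (re_form Theta) t); (d, wedge (re_form Theta) t')] fst snd.
by rewrite !big_cons !big_nil !addr0.
Qed.

Lemma kaehler_trace_lin c d t t' : kaehler_trace (c *: t + d *: t') =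
  c * kaehler_trace t + d * kaehler_trace t'.
Proof.
rewrite /kaehler_trace [c * _]mulrCA [d * _]mulrCA -mulrDr; congr (_ * _).
by rewrite !mulr_sumr -big_split.
Qed.

Lemma kaehler_trace_anti t : alternating_multilinear t ->
  J_anti_invariant J t -> kaehler_trace t = 0.
Proof.
move=> ta anti; rewrite /kaehler_trace big1 ?mulr0 // => i _.
have := anti (f i) (J (f i)); rewrite JJ form2Nr // form2C // opprK.
by move/eqP; rewrite -addr_eq0 -mulr2n mulrn_eq0 /= => /eqP.
Qed.

Lemma kaehler_trace_Omega : kaehler_trace Omega = 4%:R.
Proof.
rewrite /kaehler_trace (eq_bigr (fun=> 1)) => [|i _]; last first.
  by rewrite -[LHS]/(g (f i) (f i)) (frame_orth F) // eqxx.
by rewrite sumr_const card_ord; field.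
Qed.

Lemma J_invariant_Omega : J_invariant J Omega.
Proof. exact: su_formJ SU4. Qed.

Lemma J_pullbackE t x y : J_pullback t [tuple x; y] = t [tuple J x; J y].
Proof. by []. Qed.

Lemma J_invariantP t : J_invariant J t <-> J_pullback t = t.
Proof.
split=> [inv|E x y]; last by rewrite -J_pullbackE E.
by apply: funext => v; rewrite [in RHS](tuple2E v) -inv.
Qed.

Lemma J_anti_invariantP t : J_anti_invariant J t <-> J_pullback t = - t.
Proof.
split=> [inv|E x y]; last by rewrite -J_pullbackE E.
by apply: funext => v; rewrite [in RHS](tuple2E v) fctE -inv.
Qed.

Lemma J_pullbackK t : alternating_multilinear t ->
  J_pullback (J_pullback t) = t.
Proof.
move=> ta; apply: funext => v; rewrite /J_pullback !JJ form2Nl // form2Nr //.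
by rewrite opprK -tuple2E.
Qed.

Let pull_lin c d t t' :
  J_pullback (c *: t + d *: t') = c *: J_pullback t + d *: J_pullback t'.
Proof. by []. Qed.

(** The (1,1)-part of a real 2-form, and its part of type (2,0)+(0,2). *)
Definition J_even t : 2.-tuple W -> R^o :=
  (2^-1 : R) *: t + (2^-1 : R) *: J_pullback t.
Definition J_odd t : 2.-tuple W -> R^o :=
  (2^-1 : R) *: t + (- 2^-1 : R) *: J_pullback t.

Lemma altml_J_even t : alternating_multilinear t ->
  alternating_multilinear (J_even t).
Proof.
by move=> ta; apply: altmlD; apply: altmlZ => //; apply: altml_J_pullback.
Qed.

Lemma altml_J_odd t : alternating_multilinear t ->
  alternating_multilinear (J_odd t).
Proof.
by move=> ta; apply: altmlD; apply: altmlZ => //; apply: altml_J_pullback.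
Qed.

Lemma J_even_odd t : J_even t + J_odd t = t.
Proof.
apply: funext => v; rewrite /J_even /J_odd !fctE !regular_scaleE; by field.
Qed.

Lemma J_even_invariant t : alternating_multilinear t ->
  J_invariant J (J_even t).
Proof.
move=> ta; apply/J_invariantP; rewrite /J_even pull_lin J_pullbackK //.
exact: addrC.
Qed.

Lemma J_odd_anti t : alternating_multilinear t -> J_anti_invariant J (J_odd t).
Proof.
move=> ta; apply/J_anti_invariantP; rewrite /J_odd pull_lin J_pullbackK //.
apply: funext => v; rewrite !fctE !regular_scaleE; by field.
Qed.

Lemma hodge_re_even t : alternating_multilinear t -> S_ t = S_ (J_odd t).
Proof.
move=> ta; rewrite -{1}[t]J_even_odd.
have := hodge_re_lin 1 1 (J_even t) (J_odd t); rewrite !scale1r => -> /=.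
rewrite [X in X + _]hodge_re ?re_contraction_invariant ?add0r //.
- exact: altml_J_even.
- exact: J_even_invariant.
- exact: altml_J_even.
Qed.

(** The operator preserves the types: it is 3 on [Omega], -1 on (1,1)-forms of
    trace zero, and on the forms of type (2,0)+(0,2) it is 1 plus the star of
    the product with [Re Theta]. *)
Lemma hodge_cayley_even_odd t : alternating_multilinear t ->
  @hodge R W g 6 2 vol (wedge Phi t) =
  (kaehler_trace (J_even t) *: Omega - J_even t) + (J_odd t + S_ (J_odd t)).
Proof.
move=> ta; rewrite hodge_cayley // -hodge_re_even // addrA; congr (_ + _).
have -> : kaehler_trace t = kaehler_trace (J_even t).
  rewrite -{1}[t]J_even_odd.
  have := kaehler_trace_lin 1 1 (J_even t) (J_odd t).
  rewrite !scale1r !mul1r => ->.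
  rewrite [X in _ + X]kaehler_trace_anti ?addr0 //; first exact: altml_J_odd.
  exact: J_odd_anti.
apply: funext => v; rewrite /J_even /J_odd !fctE !regular_scaleE; by field.
Qed.

Lemma J_parts a b : J_invariant J a -> J_anti_invariant J b ->
  J_even (a + b) = a /\ J_odd (a + b) = b.
Proof.
move=> /J_invariantP Ea /J_anti_invariantP Eb.
have E : J_pullback (a + b) = a - b by rewrite -[in RHS]Ea -Eb.
split; apply: funext => v; rewrite /J_even /J_odd E !fctE !regular_scaleE;
  by field.
Qed.

(** The two equations are the parts of type (1,1) and (2,0)+(0,2) of the
    eigenvalue equation; they are separated by pulling back by [J]. *)
Lemma cayley_eigen t (x : R) : alternating_multilinear t ->
  @hodge R W g 6 2 vol (wedge Phi t) = x *: t <->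
  kaehler_trace (J_even t) *: Omega = (x + 1) *: J_even t /\
  S_ (J_odd t) = (x - 1) *: J_odd t.
Proof.
move=> ta; rewrite hodge_cayley_even_odd //.
set k := kaehler_trace _; set e := J_even t; set o := J_odd t.
have ea : alternating_multilinear e by exact: altml_J_even.
have oa : alternating_multilinear o by exact: altml_J_odd.
have tE : t = e + o by rewrite J_even_odd.
have pe : J_pullback e = e by apply/J_invariantP/J_even_invariant.
have po : J_pullback o = - o by apply/J_anti_invariantP/J_odd_anti.
have pO : J_pullback Omega = Omega by apply/J_invariantP/J_invariant_Omega.
have pS : J_pullback (S_ o) = - S_ o.
  apply/J_anti_invariantP; rewrite /= hodge_re //.
  exact: re_contraction_anti.
split=> [E|[E1 E2]]; last first.
  apply: funext => v; move/(congr1 (fun h => h v)): E1.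
  move/(congr1 (fun h => h v)): E2; rewrite tE !fctE !regular_scaleE.
  by move=> -> ->; ring.
have E' := congr1 J_pullback E.
have H v : k * Omega v - e v + (o v + S_ o v) = x * (e v + o v).
  by move/(congr1 (fun h => h v)): E; rewrite {1}tE.
have H' v : k * Omega v - e v + (- o v - S_ o v) = x * (e v - o v).
  have pl (h : 2.-tuple W -> R^o) :
      h [tuple J (tnth v 0); J (tnth v 1)] = J_pullback h v by [].
  move: (H [tuple J (tnth v 0); J (tnth v 1)]).
  by rewrite !pl pe po pO pS.
split; apply: funext => v; rewrite !fctE !regular_scaleE;
  move: (H v) (H' v) => h h'; lra.
Qed.

Lemma Lambda2_7_decomposition : is_direct_sum (Lambda2_7 g vol Phi)
    [set c *: Omega | c in [set: R]]
    [set tau | real_Lambda20_02 J tau /\ S_ tau = 2%:R *: tau].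
Proof.
split; apply/seteqP; split=> t.
- case=> ta /(cayley_eigen 3%:R ta) [E1 E2].
  exists (J_even t).
    exists (kaehler_trace (J_even t) / 4%:R) => //.
    rewrite mulrC -scalerA E1 scalerA.
    rewrite (_ : 4%:R^-1 * (3%:R + 1) = 1 :> R) ?scale1r //; by field.
  exists (J_odd t); last exact: J_even_odd.
  have oa := altml_J_odd ta; split.
    by apply/(real_Lambda20_02P JJ F oa); exact: J_odd_anti.
  by rewrite E2; congr (_ *: _); ring.
- case=> _ [c _ <-] [b [Lb Sb] <-].
  have ba : alternating_multilinear b by case: Lb.
  have anti : J_anti_invariant J b by apply/(real_Lambda20_02P JJ F ba).
  have inv : J_invariant J (c *: Omega).
    by move=> x y; rewrite !fctE J_invariant_Omega.
  have [Ee Eo] := J_parts inv anti.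
  have ta : alternating_multilinear (c *: Omega + b).
    by apply: altmlD => //; apply: altmlZ.
  split=> //; apply/(cayley_eigen 3%:R ta); rewrite Ee Eo; split.
    have := kaehler_trace_lin c 0 Omega 0.
    rewrite scale0r addr0 mul0r addr0 => ->.
    by rewrite kaehler_trace_Omega scalerA; congr (_ *: _); ring.
  by rewrite Sb; congr (_ *: _); ring.
- case=> -[c _ <-] [Lb _].
  have ca : alternating_multilinear (c *: Omega) by apply: altmlZ.
  have anti : J_anti_invariant J (c *: Omega).
    by apply/(real_Lambda20_02P JJ F ca).
  apply: funext => v; rewrite (tuple2E v).
  have := anti (tnth v 0) (tnth v 1); rewrite fctE J_invariant_Omega => /eqP.
  by rewrite -addr_eq0 -mulr2n mulrn_eq0 /= => /eqP.
- move=> ->; split; first by exists 0 => //; rewrite scale0r.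
  have a0 := altml0 W (R^o) 2.
  split; first by apply/(real_Lambda20_02P JJ F a0) => x y; rewrite oppr0.
  have := hodge_re_lin 0 0 0 0; rewrite !scale0r addr0 => ->.
  by rewrite scaler0.
Qed.

Lemma Lambda2_21_decomposition : is_direct_sum (Lambda2_21 g vol Phi)
    [set tau | real_Lambda11 J tau /\
       wedge tau (wedge (wedge Omega Omega) Omega) = 0]
    [set tau | real_Lambda20_02 J tau /\ S_ tau = - (2%:R *: tau)].
Proof.
have prim t : alternating_multilinear t ->
    wedge t (wedge (wedge Omega Omega) Omega) = 0 <-> kaehler_trace t = 0.
  move=> ta; rewrite wedge_cube //; split=> [/eqP|->]; last first.
    by rewrite mulr0 scale0r.
  rewrite scaler_eq0 mulf_eq0 pnatr_eq0 /= => /orP [/eqP //|/eqP v0].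
  by case: (su4_volume_neq0 SU4 S).
split; apply/seteqP; split=> t.
- case=> ta; rewrite -scaleN1r => /(cayley_eigen (-1) ta) [E1 E2].
  exists (J_even t).
    have ea := altml_J_even ta; split.
      by apply/(real_Lambda11P JJ F ea); exact: J_even_invariant.
    apply/prim => //; move/(congr1 kaehler_trace): E1.
    have kZ c h : kaehler_trace (c *: h) = c * kaehler_trace h.
      have := kaehler_trace_lin c 0 h 0.
      by rewrite scale0r addr0 mul0r addr0.
    rewrite !kZ kaehler_trace_Omega addNr mul0r => /eqP.
    by rewrite mulf_eq0 pnatr_eq0 orbF => /eqP.
  exists (J_odd t); last exact: J_even_odd.
  have oa := altml_J_odd ta; split.
    by apply/(real_Lambda20_02P JJ F oa); exact: J_odd_anti.
  by rewrite E2 -scaleNr; congr (_ *: _); ring.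
- case=> a [La a0] [b [Lb Sb] <-].
  have aa : alternating_multilinear a by case: La.
  have ba : alternating_multilinear b by case: Lb.
  have inv : J_invariant J a by apply/(real_Lambda11P JJ F aa).
  have anti : J_anti_invariant J b by apply/(real_Lambda20_02P JJ F ba).
  have [Ee Eo] := J_parts inv anti.
  have ta : alternating_multilinear (a + b) by apply: altmlD.
  split=> //; rewrite -scaleN1r; apply/(cayley_eigen (-1) ta); rewrite Ee Eo.
  split; first by move/prim: a0 => -> //; rewrite addNr !scale0r.
  by rewrite Sb -scaleNr; congr (_ *: _); ring.
- case=> -[La _] [Lb _].
  have ta : alternating_multilinear t by case: La.
  have inv : J_invariant J t by apply/(real_Lambda11P JJ F ta).
  have anti : J_anti_invariant J t by apply/(real_Lambda20_02P JJ F ta).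
  apply: funext => v; rewrite (tuple2E v).
  have := anti (tnth v 0) (tnth v 1); rewrite inv => /eqP.
  by rewrite -addr_eq0 -mulr2n mulrn_eq0 /= => /eqP.
- move=> ->; have a0 := altml0 W (R^o) 2; split; split.
  + by apply/(real_Lambda11P JJ F a0).
  + apply/prim => //; have := kaehler_trace_lin 0 0 0 0.
    by rewrite !scale0r addr0 !mul0r addr0.
  + by apply/(real_Lambda20_02P JJ F a0) => x y; rewrite oppr0.
  have := hodge_re_lin 0 0 0 0; rewrite !scale0r addr0 => ->.
  by rewrite scaler0 oppr0.
Qed.

End LambdaTwo.

Theorem theorem11p6 (R : realType) (W : vectType R) (dimW : \dim {:W} = 8%N)
    (Omega : 2.-tuple W -> R^o) (J : 'End(W))
    (Theta : 4.-tuple W -> Rcomplex R)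
    (SU4 : @is_SU_structure R W 4 Omega J Theta) :
  let g := su_metric Omega J in
  let vol := su4_volume Omega in
  let Phi := su4_form Omega Theta in
  [/\ is_positive_cayley_form Phi,
      compatible_orientation Phi vol
    & compatible_inner_product Phi g] /\
  is_direct_sum (Lambda2_7 g vol Phi)
    [set c *: Omega | c in [set: R]]
    [set tau | real_Lambda20_02 J tau /\
       @hodge R W g 6 2 vol (wedge (re_form Theta) tau) = 2%:R *: tau] /\
  is_direct_sum (Lambda2_21 g vol Phi)
    [set tau | real_Lambda11 J tau /\
       wedge tau (wedge (wedge Omega Omega) Omega) = 0]
    [set tau | real_Lambda20_02 J tau /\
       @hodge R W g 6 2 vol (wedge (re_form Theta) tau) = - (2%:R *: tau)].
Proof.
move=> g vol Phi; have [f [S _ _ _]] := adapted_su_frame dimW SU4 0 0 0.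
have comp := cayley_compatible dimW SU4.
split; last first.
  split; first exact: Lambda2_7_decomposition S.
  exact: Lambda2_21_decomposition S.
split=> //; last exact: cayley_orientation dimW SU4.
split; last by move=> u v; apply: (cayley_positive dimW SU4).
by split; [exact: altml_cayley SU4 | exists g].
Qed.
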